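(* Let $k$ be an algebraically closed field of characteristic $2$ and let $G$ be a finite group of even order. Let $\mathcal{B}$ be a real $2$-block of $G$, with extended defect group $E$. Then: (i) Each symmetric vertex of an indecomposable $\mathcal{B}$-module (of symmetric type) is $G$-conjugate to a subgroup of $E$. (ii) Some self-dual irreducible $\mathcal{B}$-module has symmetric vertex $E$. (iii) Let $B_1$ be the bilinear form on $kG$ with respect to which the elements of $G$ form an orthonormal basis. Then the restriction of $B_1$ to $\mathcal{B}$ is non-degenerate and $\Delta E$-projective, where $\Delta E=\{(x,x)\mid x\in E\}\leq G\times G$. So $\Delta E$ is a symmetric vertex of $\mathcal{B}$, regarded as a $k(G\times G)$-module.
   Context: All modules are finite-dimensional left modules. $kG$ is a $k(G\times G)$-module via $(g_1,g_2)x=g_1xg_2^{-1}$; its indecomposable direct summands are the ($2$-)blocks of $kG$, and $B_1$ is $G\times G$-invariant. The contragredient map $^o$ is the $k$-linear anti-automorphism of $kG$ with $g^o=g^{-1}$ for $g\in G$. A block $\mathcal{B}=kGe_{\mathcal{B}}$ ($e_{\mathcal{B}}$ a primitive idempotent of $Z(kG)$) is real if $\mathcal{B}^o=\mathcal{B}$. Defect groups. Let $\omega_{\mathcal{B}}:Z(kG)\to k$ be the $k$-algebra map with $\omega_{\mathcal{B}}(e_{\mathcal{B}})=1$. A defect class of $\mathcal{B}$ is a conjugacy class $C$ of $G$ such that the coefficient of the class sum $C^+$ in $e_{\mathcal{B}}$ is non-zero and $\omega_{\mathcal{B}}(C^+)\neq 0$. A class is real if it is closed under inversion. A real block has a real defect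 class (Gow). For $c\in C$ with $C$ a real defect class, the extended centralizer is $C_G^*(c)=\{g\in G\mid gcg^{-1}\in\{c,c^{-1}\}\}$; an extended defect group of $\mathcal{B}$ is a Sylow $2$-subgroup $E$ of $C_G^*(c)$. Symmetric vertices. For any finite group $X$, an $X$-form on a $kX$-module $M$ is a non-degenerate $X$-invariant symmetric bilinear form $B:M\times M\to k$; then $(M,B)$ is a symmetric $kX$-module and $M$ has symmetric type. $(L,B_L)$ is a component of $(M,B)$ if there is a form-preserving $kX$-homomorphism $(L,B_L)\to(M,B)$. For $H\le X$ and a symmetric $kH$-module $(L,B_L)$, $\mathrm{Ind}_H^X(L,B_L)$ is $\mathrm{Ind}_H^X L$ with the form $B_L^X(g_1\otimes \ell_1,g_2\otimes \ell_2)=B_L(g_2^{-1}g_1\ell_1,\ell_2)$ if $g_1H=g_2H$ and $0$ otherwise. An $X$-form $B$ on $M$ is $H$-projective if $(M,B)$ is a component of $\mathrm{Ind}_H^X(L,B_L)$ for some symmetric $kH$-module $(L,B_L)$. $M$ is symmetrically $H$-projective if it affords an $H$-projective $X$-form. If $M$ is indecomposable of symmetric type, a symmetric vertex of $M$ is a subgroup of $X$ minimal (under inclusion) subject to $M$ being symmetrically projective relative to it. *)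

(* Defs.v *)
From mathcomp Require Import all_boot all_order all_fingroup all_algebra.
From mathcomp Require Import all_solvable all_field all_character.

Set Implicit Arguments.
Unset Strict Implicit.
Unset Printing Implicit Defensive.

Import GroupScope GRing.Theory.
Local Open Scope ring_scope.

(* A matrix representation rM of X acts on row vectors on the right; it is    *)
(* read here as the left kX-module k^n with g . v = v *m rM g^-1. Submodules  *)
(* (mxmodule), irreducibility (mx_irreducible), homomorphisms and isomorphism *)
(* (mx_rsim) are the same for both readings. A bilinear form on k^n is given  *)
(* by its Gram matrix B, i.e., B(u, v) = u *m B *m v^T.                       *)

Section SymmetricModules.

Variables (k : fieldType) (gT : finGroupType).
Implicit Types X H K : {group gT}.

Definition lact (X : {set gT}) n (rM : mx_representation k X n)
    (g : gT) (v : 'rV[k]_n) : 'rV[k]_n := v *m rM g^-1%g.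

Definition bform n (B : 'M[k]_n) (u v : 'rV[k]_n) : k := (u *m B *m v^T) 0 0.

Definition X_form X n (rM : mx_representation k X n) (B : 'M[k]_n) : Prop :=
  [/\ B^T = B, B \in unitmx
    & {in X, forall g, rM g *m B *m (rM g)^T = B}].

Definition sym_type X n (rM : mx_representation k X n) : Prop :=
  exists B, X_form rM B.

Definition component X m n (rL : mx_representation k X m) (BL : 'M[k]_m)
    (rM : mx_representation k X n) (BM : 'M[k]_n) : Prop :=
  exists2 f : 'M[k]_(m, n),
    {in X, forall g, rL g *m f = f *m rM g} & f *m BM *m f^T = BL.

Definition mx_indecomposable X n (rM : mx_representation k X n) : Prop :=
  (0 < n)%N /\
  forall U V : 'M[k]_n, mxmodule rM U -> mxmodule rM V ->
    (U + V :=: 1%:M)%MS -> (U :&: V)%MS = 0 -> U = 0 \/ V = 0.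

(* The functional v |-> v *m w^T is represented by the row vector w. *)
Definition dual_mx X n (rM : mx_representation k X n) (g : gT) : 'M[k]_n :=
  (rM g^-1%g)^T.

Lemma dual_mx_repr X n (rM : mx_representation k X n) :
  mx_repr X (dual_mx rM).
Proof.
split=> [|x y Xx Xy]; first by rewrite /dual_mx invg1 repr_mx1 trmx1.
by rewrite /dual_mx invMg repr_mxM ?groupV // trmx_mul.
Qed.

Canonical dual_repr X n (rM : mx_representation k X n) :=
  MxRepresentation (dual_mx_repr rM).

Definition self_dual X n (rM : mx_representation k X n) : Prop :=
  mx_rsim rM (dual_repr rM).

(* Induction: with t_i the chosen representatives of the left cosets of H in  *)
(* X, the space of Ind_H^X L is the direct sum of the t_i (x) L; see ind_lact *)
(* and ind_bform below for the action and the form on pure tensors g (x) l.   *)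
Definition lrep X H (i : 'I_#|lcosets H X|) : gT := repr (enum_val i).

Definition ind_mx X H n (rL : mx_representation k H n) (g : gT) :
    'M[k]_(\sum_(i < #|lcosets H X|) n) :=
  \mxblock_(i < #|lcosets H X|, j < #|lcosets H X|)
    (let h := ((lrep i)^-1 * g * lrep j)%g in if h \in H then rL h else 0).

Definition ind_form X H n (BL : 'M[k]_n) :
    'M[k]_(\sum_(i < #|lcosets H X|) n) :=
  \mxdiag_(i < #|lcosets H X|) BL.

Definition pure_tensor X H n (rL : mx_representation k H n) (g : gT)
    (l : 'rV[k]_n) : 'rV[k]_(\sum_(i < #|lcosets H X|) n) :=
  \mxrow_(i < #|lcosets H X|)
    (let h := ((lrep i)^-1 * g)%g in if h \in H then lact rL h l else 0).

Lemma lrep_inH X H g i :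
  ((@lrep X H i)^-1 * g \in H)%g = (enum_val i == g *: H)%g.
Proof.
have /lcosetsP[x _ Ei] := enum_valP i.
have: (lrep i \in x *: H)%g by rewrite /lrep Ei (mem_repr x) ?lcoset_refl.
rewrite Ei -mem_lcoset => /lcoset_eqP->; rewrite [RHS]eq_sym.
by apply/lcoset_eqP/eqP.
Qed.

Lemma lrepP X H g : g \in X ->
  exists2 i : 'I_#|lcosets H X|, ((lrep i)^-1 * g)%g \in H
    & forall j, ((lrep j)^-1 * g)%g \in H -> j = i.
Proof.
move=> Xg; have Cg: (g *: H)%g \in lcosets H X by apply/lcosetsP; exists g.
exists (enum_rank_in Cg (g *: H)%g) => [|j].
  by rewrite lrep_inH enum_rankK_in.
by rewrite lrep_inH => /eqP Ej; apply: enum_val_inj; rewrite enum_rankK_in.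
Qed.

Lemma lrep_uniq X H g i j : ((@lrep X H i)^-1 * g)%g \in H ->
  ((@lrep X H j)^-1 * g)%g \in H -> i = j.
Proof.
by rewrite !lrep_inH => /eqP Ei /eqP Ej; apply: enum_val_inj; rewrite Ei.
Qed.

Lemma lrep_ex X H x i : x \in X ->
  exists j : 'I_#|lcosets H X|, ((lrep j)^-1 * (x * @lrep X H i))%g \in H.
Proof.
move=> Xx; have /lcosetsP[y Xy Ei] := enum_valP i.
have [j Hj _] := lrepP H (groupM Xx Xy); exists j.
move: Hj; rewrite !lrep_inH !lcosetM => /eqP->; rewrite -Ei; apply/eqP.
congr (_ *: _)%g; apply/eqP; rewrite -lrep_inH mulVg; exact: group1.
Qed.

Lemma ind_mx_repr X H n (rL : mx_representation k H n) :
  mx_repr X (@ind_mx X H n rL).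
Proof.
split=> [|x y Xx Xy].
  rewrite -mxdiagZ; apply/eq_mxblockP => i j.
  rewrite mulg1; have [->|ne_ij] := eqVneq i j.
    by rewrite /= mulVg group1 repr_mx1 conform_mx_id.
  rewrite /=; case: ifP => // Hij; case/eqP: ne_ij.
  by apply: (lrep_uniq Hij); rewrite mulVg group1.
rewrite mul_mxblock; apply/eq_mxblockP => i j /=.
have [l Hl] := lrep_ex j Xy; rewrite (bigD1 l) //= big1 ?addr0 => [|l' ne_l].
  rewrite -[((lrep l)^-1 * y * _)%g]mulgA Hl.
  have ->: ((lrep i)^-1 * (x * y) * lrep j
     = ((lrep i)^-1 * x * lrep l) * ((lrep l)^-1 * (y * lrep j)))%g.
    by rewrite !mulgA mulgK.
  rewrite groupMr //; case: ifP => Hi; last by rewrite mul0mx.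
  by rewrite repr_mxM.
rewrite -[((lrep l')^-1 * y * _)%g]mulgA.
case Hl': ((_^-1 * (y * _))%g \in H); last by rewrite mulmx0.
by rewrite (lrep_uniq Hl' Hl) eqxx in ne_l.
Qed.

Canonical ind_repr X H n (rL : mx_representation k H n) :=
  MxRepresentation (@ind_mx_repr X H n rL).

Lemma pure_tensorZ X H n (rL : mx_representation k H n) g h l : h \in H ->
  @pure_tensor X H n rL (g * h)%g l = pure_tensor X rL g (lact rL h l).
Proof.
move=> Hh; apply/eq_mxrowP => i /=; rewrite mulgA groupMr //.
by case: ifP => // Hg; rewrite /lact invMg repr_mxM ?groupV // mulmxA.
Qed.

Lemma ind_lact X H n (rL : mx_representation k H n) x g l :
  x \in X -> g \in X ->
  lact (ind_repr X rL) x (pure_tensor X rL g l) = pure_tensor X rL (x * g)%g l.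
Proof.
move=> Xx Xg; rewrite /lact /= /pure_tensor mul_mxrow_mxblock.
apply/eq_mxrowP => i /=.
have [j Hj _] := lrepP H Xg.
rewrite (bigD1 j) //= big1 ?addr0 => [|j' ne_j]; last first.
  case: ifP => [Hj'|]; last by rewrite mul0mx.
  by rewrite (lrep_uniq Hj' Hj) eqxx in ne_j.
rewrite Hj; have ->: ((lrep j)^-1 * x^-1 * lrep i
   = ((lrep j)^-1 * g) * ((lrep i)^-1 * (x * g))^-1)%g.
  by rewrite !invMg invgK !mulgA mulgK.
rewrite groupMl // groupV; case: ifP => Hi; last by rewrite mulmx0.
rewrite /lact -mulmxA -repr_mxM ?groupV //; last by rewrite groupMl ?groupV.
by rewrite mulKg.
Qed.

Lemma ind_bform X H n (rL : mx_representation k H n) (BL : 'M[k]_n)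
    g1 g2 l1 l2 :
  X_form rL BL -> g1 \in X -> g2 \in X ->
  bform (ind_form X H BL) (pure_tensor X rL g1 l1) (pure_tensor X rL g2 l2) =
  if (g1 *: H == g2 *: H)%g then bform BL (lact rL (g2^-1 * g1)%g l1) l2 else 0.
Proof.
case=> _ _ BLinv Xg1 Xg2; rewrite /bform /pure_tensor /ind_form.
rewrite mul_mxrow_mxdiag tr_mxrow mul_mxrow_mxcol.
have [i Hi _] := lrepP H Xg1.
rewrite (bigD1 i) //= big1 ?addr0 => [|j ne_j]; last first.
  case: ifP => [Hj|]; last by rewrite !mul0mx.
  by rewrite (lrep_uniq Hj Hi) eqxx in ne_j.
rewrite Hi lrep_inH; move: (Hi); rewrite lrep_inH => /eqP->.
case: ifP => [E|]; last by rewrite trmx0 mulmx0 mxE.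
have Hi2: ((lrep i)^-1 * g2)%g \in H.
  by rewrite lrep_inH -(eqP E) -lrep_inH.
rewrite /lact; set a := ((lrep i)^-1 * g1)%g in Hi *.
set b := ((lrep i)^-1 * g2)%g in Hi2 *.
have ->: ((g2^-1 * g1)^-1 = a^-1 * b)%g by rewrite !invMg !invgK mulgA mulgK.
rewrite repr_mxM ?groupV // trmx_mul !mulmxA.
rewrite -{2}[BL](BLinv (b^-1)%g) ?groupV //.
by rewrite !mulmxA -[_ *m rL b *m _]mulmxA -repr_mxM ?groupV // mulgV repr_mx1
  mulmx1.
Qed.

Definition form_projective X n (rM : mx_representation k X n) (B : 'M[k]_n)
    H : Prop :=
  [/\ X_form rM B, H \subset X
    & exists m (rL : mx_representation k H m) (BL : 'M[k]_m),
        X_form rL BL /\ component rM B (ind_repr X rL) (ind_form X H BL)].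

Definition sym_projective X n (rM : mx_representation k X n) H : Prop :=
  exists B, form_projective rM B H.

Definition sym_vertex X n (rM : mx_representation k X n) H : Prop :=
  [/\ mx_indecomposable rM, sym_type rM, sym_projective rM H
    & forall K, K \subset H -> sym_projective rM K -> K :=: H].

End SymmetricModules.

Section Blocks.

Variables (k : fieldType) (gT : finGroupType) (G : {group gT}).

(* The group algebra kG is used in its two library incarnations: the row      *)
(* vectors 'rV_#|G| indexed by the elements of G, and the matrix algebra      *)
(* group_ring k G; the matrix of a \in kG describes x |-> x a, so that the    *)
(* row space of this matrix is the left ideal kG a.                           *)

Definition gcoef (a : 'M[k]_#|G|) (x : gT) : k :=
  gring_row a 0 (gring_index G x).

Definition gbasis (x : gT) : 'rV[k]_#|G| := delta_mx 0 (gring_index G x).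

Definition bireg_mx (g : gT * gT) : 'M[k]_#|G| :=
  \matrix_i gbasis (g.1^-1 * enum_val i * g.2)%g.

Lemma bireg_mx_repr : mx_repr (setX G G) bireg_mx.
Proof.
split=> [|[x1 x2] [y1 y2]].
  apply/row_matrixP=> i; rewrite rowK /= invg1 mul1g mulg1 /gbasis gring_valK.
  by rewrite row1.
rewrite !inE /= => /andP[Gx1 Gx2] /andP[Gy1 Gy2].
apply/row_matrixP=> i; rewrite row_mul !rowK -rowE rowK /= gring_indexK.
  by rewrite invMg !mulgA.
by rewrite !groupM ?groupV ?enum_valP.
Qed.

Canonical bireg_repr :=
  @MxRepresentation k _ (setX_group G G) _ _ bireg_mx_repr.

Lemma bireg_lact g1 g2 x : g1 \in G -> g2 \in G -> x \in G ->
  lact bireg_repr (g1, g2) (gbasis x) = gbasis (g1 * x * g2^-1)%g.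
Proof.
by move=> G1 G2 Gx; rewrite /lact -rowE rowK /= invgK gring_indexK.
Qed.

Definition contragredient_mx : 'M[k]_#|G| := \matrix_i gbasis (enum_val i)^-1%g.

Definition block_idempotent (e : 'M[k]_#|G|) : Prop :=
  [/\ (e \in 'Z(group_ring k G))%MS, e *m e = e, e != 0
    & forall f1 f2 : 'M[k]_#|G|,
        (f1 \in 'Z(group_ring k G))%MS -> (f2 \in 'Z(group_ring k G))%MS ->
        f1 *m f1 = f1 -> f2 *m f2 = f2 -> f1 *m f2 = 0 -> f1 + f2 = e ->
        f1 = 0 \/ f2 = 0].

Definition real_block (e : 'M[k]_#|G|) : Prop :=
  (e *m contragredient_mx :=: e)%MS.

(* Since x . v = v *m rM x^-1, this says that e acts as the identity. *)
Definition belongs_to (e : 'M[k]_#|G|) n (rM : mx_representation k G n) :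
    Prop :=
  \sum_(x in G) gcoef e x *: rM x^-1%g = 1%:M.

Definition central_character (e : 'M[k]_#|G|) (w : 'M[k]_#|G| -> k) : Prop :=
  [/\ forall (a : k) (A B : 'M[k]_#|G|),
        (A \in 'Z(group_ring k G))%MS -> (B \in 'Z(group_ring k G))%MS ->
        w (a *: A + B) = a * w A + w B,
      forall A B : 'M[k]_#|G|,
        (A \in 'Z(group_ring k G))%MS -> (B \in 'Z(group_ring k G))%MS ->
        w (A *m B) = w A * w B,
      w 1%:M = 1
    & w e = 1].

Definition defect_class (e : 'M[k]_#|G|) (C : {set gT}) : Prop :=
  [/\ C \in classes G, {in C, forall x, gcoef e x != 0}
    & exists2 w, central_character e w & w (gset_mx k G C) != 0].

Definition ext_centralizer (c : gT) : {set gT} :=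
  [set g in G | (g * c * g^-1)%g \in [set c; c^-1%g]].

Definition extended_defect_group (e : 'M[k]_#|G|) (E : {group gT}) : Prop :=
  exists (C : {set gT}) (c : gT),
    [/\ defect_class e C, (C^-1)%g = C, c \in C
      & 2.-Sylow(ext_centralizer c) E].

Lemma ext_centralizer_group_set c : group_set (ext_centralizer c).
Proof.
apply/group_setP; split=> [|x y].
  by rewrite !inE group1 mul1g invg1 mulg1 eqxx.
rewrite !inE => /andP[Gx Ex] /andP[Gy Ey]; rewrite groupM //=.
have ->: (x * y * c * (x * y)^-1 = x * (y * c * y^-1) * x^-1)%g.
  by rewrite invMg !mulgA.
case/orP: Ey => /eqP-> //.
have ->: (x * c^-1 * x^-1 = (x * c * x^-1)^-1)%g.
  by rewrite !invMg invgK mulgA.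
by rewrite (can2_eq invgK invgK) (inj_eq invg_inj) orbC.
Qed.

Canonical ext_centralizer_group c := Group (ext_centralizer_group_set c).

Lemma bireg_mx_reg x y : x \in G -> y \in G ->
  bireg_mx (x, y) = bireg_mx (x, 1%g) *m regular_repr k G y.
Proof.
move=> Gx Gy; apply/row_matrixP=> i; rewrite row_mul !rowK -rowE rowK /=.
by rewrite gring_indexK ?mulg1 // groupM ?groupV ?enum_valP.
Qed.

Lemma bireg_mx_regC x z : x \in G -> z \in G ->
  regular_repr k G z *m bireg_mx (x, 1%g) =
  bireg_mx (x, 1%g) *m regular_repr k G z.
Proof.
move=> Gx Gz; apply/row_matrixP=> i; rewrite !row_mul !rowK -!rowE !rowK /=.
by rewrite !gring_indexK ?mulg1 ?mulgA // groupM ?groupV ?enum_valP.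
Qed.

Lemma block_module (e : 'M[k]_#|G|) :
  block_idempotent e -> mxmodule bireg_repr e.
Proof.
case=> /center_mxP[Re cRe] _ _ _; apply/mxmoduleP=> -[x y].
rewrite inE /= => /andP[Gx Gy]; rewrite bireg_mx_reg //.
have cxe: e *m bireg_mx (x, 1%g) = bireg_mx (x, 1%g) *m e.
  have [a ->] := envelop_mxP Re.
  rewrite mulmx_suml mulmx_sumr; apply: eq_bigr => z Gz.
  by rewrite -scalemxAl bireg_mx_regC // scalemxAr.
rewrite mulmxA cxe -mulmxA -cRe ?envelop_mx_id // mulmxA; exact: submxMl.
Qed.

Definition block_repr (e : 'M[k]_#|G|) (He : block_idempotent e) :
    mx_representation k (setX G G) (\rank e) :=
  submod_repr (block_module He).

(* The Gram matrix of B_1 on kG is the identity; this is the Gram matrix of   *)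
(* its restriction to kG e in the coordinates of block_repr.                  *)
Definition block_form (e : 'M[k]_#|G|) : 'M[k]_(\rank e) :=
  \matrix_(i, j) bform 1%:M (val_submod (delta_mx 0 i : 'rV_(\rank e)))
                            (val_submod (delta_mx 0 j : 'rV_(\rank e))).

End Blocks.

Definition diag_set (gT : finGroupType) (E : {set gT}) : {set gT * gT} :=
  [set (x, x) | x in E].

Lemma diag_group_set (gT : finGroupType) (E : {group gT}) :
  group_set (diag_set E).
Proof.
apply/group_setP; split=> [|_ _ /imsetP[x Ex ->] /imsetP[y Ey ->]].
  by apply/imsetP; exists 1%g.
by apply/imsetP; exists (x * y)%g; rewrite ?groupM.
Qed.

Canonical diag_group (gT : finGroupType) (E : {group gT}) :=
  Group (diag_group_set E).

(* Main.v *)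
Require Import Defs.
From mathcomp Require Import all_boot all_order all_fingroup all_algebra.
From mathcomp Require Import all_solvable all_field all_character.

Set Implicit Arguments.
Unset Strict Implicit.
Unset Printing Implicit Defensive.

Import GroupScope GRing.Theory.
Local Open Scope ring_scope.

(** A form B on M is H-projective exactly when it is a relative trace Tr_H^G(B')
    of an H-invariant symmetric form B' on M, which may be degenerate
    (form_projectiveI, form_projectiveE). So the theorem is about writing forms
    as relative traces from small subgroups.

    Let c lie in a real defect class C. In the local algebra Z(kG)e the class sum
    C^+ e has an inverse y, fixed by g |-> g^-1 (real_defect_data), and C^+ is
    the relative trace of c + c^-1 (of c if c = c^-1) from the extended
    centralizer of c, hence from E (rclass_sum). For a form B on a module of the
    block, B(C^+ u, v) is therefore again a regular form, and it is E-projective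
    (ext_defect_projective).

    Part (i). Let B = Tr_T(B') with T a symmetric vertex, a 2-group. An
    idempotent of Z(kG) is supported on elements of odd order
    (idempotent_support), so each s in C has a square root r in <s>, and
    B(s u, v) can be split into the terms B'(r u, r^-1 v). Transposition
    exchanges s and s^-1, and it follows that B(C^+ u, v) is a sum, over the
    T-orbits on the pairs {s, s^-1}, of relative traces of symmetric forms from
    the extended centralizers of s in T. The endomorphism ring is local, so one
    summand is regular; T being minimal, T lies in the extended centralizer of
    some s in C.

    Part (ii). If P is a 2-subgroup of the extended centralizer of v and the
    trace of v on M is nonzero, then M is symmetrically K-projective only if K
    contains a conjugate of P (trace_vertex). So it suffices to find a self-dual
    irreducible module M of the block on which a suitable v in <c> has nonzero
    trace. On the permutation module on the cosets of a Sylow 2-subgroup, the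
    trace of e v is a root of a coefficient e_c, which is nonzero because C is a
    defect class (root_sum_iter, trace_perm). This module carries an invariant
    form, and splitting off isotropic submodules in dual pairs, on which the
    traces cancel, leads to an irreducible module with a form
    (witt_irreducible).

    Part (iii). B_1(x e, y) is the sum of the e_s x_a y_b with b^-1 a = s. As
    s has odd order, (a, b) lies in the G x G-orbit of (r, r^-1), with r the
    square root of s, and e = Tr_E(y (c + c^-1)) lifts to an expression of
    B_1(x e, y) as a relative trace from Delta E (source_form_trace). If the
    block were projective relative to Delta K with K < E, contracting its form
    with the form of the module found in (ii) would make that module
    K-projective (block_projective_restrict). *)

(** * Relative traces by partitions of unity *)

Section Weights.

Variables (k : fieldType) (gT : finGroupType).
Implicit Types (X H K : {group gT}) (V : lmodType k).

(** A weight turns a sum over a transversal of X / H into a sum over all of X,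
    which can be reindexed freely; in characteristic 2 one cannot divide the
    latter by #|H| instead. *)
Definition weight H X (chi : gT -> k) : Prop :=
  {in X, forall x, \sum_(h in H) chi (x * h)%g = 1}.

Definition rinv V H X (F : gT -> V) : Prop :=
  {in X & H, forall x h, F (x * h)%g = F x}.

Lemma sum_mulgr V X (F : gT -> V) h : h \in X ->
  \sum_(x in X) F (x * h)%g = \sum_(x in X) F x.
Proof.
move=> Xh; rewrite [RHS](reindex_inj (mulIg h)) /=.
by apply: eq_bigl => x; rewrite groupMr.
Qed.

Lemma sum_mulgl V X (F : gT -> V) h : h \in X ->
  \sum_(x in X) F (h * x)%g = \sum_(x in X) F x.
Proof.
move=> Xh; rewrite [RHS](reindex_inj (mulgI h)) /=.
by apply: eq_bigl => x; rewrite groupMl.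
Qed.

Lemma sum_conjg V X (F : gT -> V) h : h \in X ->
  \sum_(x in X) F (x ^ h)%g = \sum_(x in X) F x.
Proof.
move=> Xh; rewrite [RHS](reindex_inj (conjg_inj h)) /=.
by apply: eq_bigl => x; rewrite groupJr.
Qed.

Lemma sum_invg V X (F : gT -> V) :
  \sum_(x in X) F (x^-1)%g = \sum_(x in X) F x.
Proof.
rewrite [RHS](reindex_inj invg_inj) /=.
by apply: eq_bigl => x; rewrite groupV.
Qed.

(** Insert 1 = \sum_h psi (x * h) under one sum, move h by invariance, and
    recognise 1 = \sum_h chi (x * h^-1). *)
Lemma weight_indep V H X chi psi (F : gT -> V) : H \subset X ->
  weight H X chi -> weight H X psi -> rinv H X F ->
  \sum_(x in X) chi x *: F x = \sum_(x in X) psi x *: F x.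
Proof.
move=> sHX chiP psiP FP.
transitivity (\sum_(x in X) \sum_(h in H) (chi x * psi (x * h)%g) *: F x).
  apply: eq_bigr => x Xx; rewrite -scaler_suml -mulr_sumr psiP ?mulr1 //.
rewrite exchange_big /=.
transitivity (\sum_(h in H) \sum_(x in X) (chi (x * h^-1)%g * psi x) *: F x).
  apply: eq_bigr => h Hh; have Xh := subsetP sHX h Hh.
  rewrite -(sum_mulgr _ (groupVr Xh)); apply: eq_bigr => x Xx.
  by rewrite mulgKV FP ?groupV.
rewrite exchange_big /=; apply: eq_bigr => x Xx.
rewrite -scaler_suml -mulr_suml.
have -> : \sum_(h in H) chi (x * h^-1)%g = 1.
  rewrite -(sum_invg (V := k^o)) -[RHS](chiP x Xx).
  by apply: eq_bigr => h _; rewrite invgK.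
by rewrite mul1r.
Qed.

Definition coset_weight H (x : gT) : k := (x == repr (x *: H)%g)%:R.

Lemma repr_lcoset_mem H x : repr (x *: H)%g \in (x *: H)%g.
Proof. exact: (mem_repr x (lcoset_refl H x)). Qed.

Lemma coset_weightP H X : weight H X (coset_weight H).
Proof.
move=> x _; have := repr_lcoset_mem H x; rewrite mem_lcoset => Hr.
rewrite (bigD1 (x^-1 * repr (x *: H))%g) //= big1 ?addr0 => [|h /andP[Hh neh]].
  by rewrite /coset_weight lcosetM (lcoset_id Hr) mulKVg eqxx.
rewrite /coset_weight lcosetM (lcoset_id Hh); case: eqP => // def_r.
by rewrite -def_r mulKg eqxx in neh.
Qed.

Lemma lrep_mem H X (i : 'I_#|lcosets H X|) : H \subset X -> lrep i \in X.
Proof.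
move=> sHX; rewrite /lrep; have /lcosetsP[y Xy ->] := enum_valP i.
have := repr_lcoset_mem H y; rewrite mem_lcoset => Hy.
by rewrite -[repr _](mulKVg y) groupM // (subsetP sHX).
Qed.

Lemma coset_weight_sum V H X (F : gT -> V) : H \subset X ->
  \sum_(x in X) coset_weight H x *: F x = \sum_(i < #|lcosets H X|) F (@lrep _ X H i).
Proof.
move=> sHX.
rewrite (bigID (fun x => x == repr (x *: H)%g)) /= [X in _ + X]big1 ?addr0; last first.
  by move=> x /andP[_ /negPf nx]; rewrite /coset_weight nx scale0r.
have lX i : @lrep _ X H i \in X by apply: lrep_mem.
have lE i : (@lrep _ X H i *: H)%g = enum_val i :> {set gT}.
  by apply/esym/eqP; rewrite -lrep_inH mulVg group1.
have C1 : (1 *: H)%g \in lcosets H X by apply/lcosetsP; exists 1%g.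
rewrite (reindex_onto (@lrep _ X H) (fun x => enum_rank_in C1 (x *: H)%g)) /=.
  apply: eq_big => [i|i /andP[/andP[_ /eqP Ei] _]].
    rewrite lX lE /lrep eqxx /=; apply/eqP.
    by apply: enum_val_inj; rewrite enum_rankK_in ?enum_valP.
  by rewrite /coset_weight -Ei eqxx scale1r.
move=> x /andP[Xx /eqP def_x]; rewrite /lrep enum_rankK_in -?def_x //.
by apply/lcosetsP; exists x.
Qed.

(** The convolution of a weight for H in X and one for K in H is a weight for K
    in X; this is the transitivity of relative traces. *)
Lemma weight_trans H K X chi psi : K \subset H -> H \subset X ->
  weight H X chi -> weight K H psi ->
  weight K X (fun x => \sum_(h in H) chi (x * h^-1)%g * psi h).
Proof.
move=> sKH sHX chiP psiP x Xx; rewrite exchange_big /=.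
have eq1 : \sum_(h in H) chi (x * h^-1)%g = 1.
  by rewrite (sum_invg (V := k^o) H (fun h => chi (x * h)%g)) chiP.
transitivity (\sum_(h in H) \sum_(u in K) (chi (x * h^-1)%g * psi (h * u)%g)).
  rewrite exchange_big [RHS]exchange_big /=; apply: eq_bigr => u Ku.
  have Hu := subsetP sKH u Ku.
  rewrite -(sum_mulgr (V := k^o) _ Hu); apply: eq_bigr => h Hh.
  by rewrite invMg -mulgA mulKVg.
rewrite -[RHS]eq1; apply: eq_bigr => h Hh.
by rewrite -mulr_sumr psiP ?mulr1.
Qed.

Lemma weight_trans_sum V H X (chi psi : gT -> k) (F : gT -> V) : H \subset X ->
  \sum_(x in X) (\sum_(h in H) chi (x * h^-1)%g * psi h) *: F x
  = \sum_(x in X) chi x *: \sum_(h in H) psi h *: F (x * h)%g.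
Proof.
move=> sHX.
transitivity (\sum_(h in H) \sum_(x in X) chi (x * h^-1)%g *: (psi h *: F x)).
  rewrite exchange_big /=; apply: eq_bigr => x Xx; rewrite scaler_suml.
  by apply: eq_bigr => h _; rewrite scalerA.
transitivity (\sum_(h in H) \sum_(x in X) chi x *: (psi h *: F (x * h)%g)).
  apply: eq_bigr => h Hh.
  rewrite -(sum_mulgr (V := V) _ (subsetP sHX h Hh)); apply: eq_bigr => x Xx.
  by rewrite mulgK.
by rewrite exchange_big /=; apply: eq_bigr => x Xx; rewrite scaler_sumr.
Qed.

(** If #|H : K| is odd, then it is 1 in k, and a sum over the cosets of H can be
    replaced by the sum over those of K. *)
Lemma weight_odd H K X chi : 2%N \in [pchar k] -> K \subset H -> H \subset X ->
  odd #|H : K| -> weight K X chi -> weight H X chi.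
Proof.
move=> ch2 sKH sHX oddHK chiP x Xx.
rewrite -[LHS]mulr1n.
have -> : \sum_(h in H) chi (x * h)%g
  = \sum_(h in H) \sum_(u in K) coset_weight K (h * u)%g * chi (x * h)%g.
  by apply: eq_bigr => h Hh; rewrite -mulr_suml (coset_weightP K Hh) mul1r.
rewrite exchange_big /=.
transitivity (\sum_(u in K) \sum_(h in H) coset_weight K h * chi (x * (h * u^-1))%g).
  apply: eq_bigr => u Ku; have Hu := subsetP sKH u Ku.
  rewrite -(sum_mulgr (V := k^o) _ (groupVr Hu)); apply: eq_bigr => h Hh.
  by rewrite mulgKV mulgA.
rewrite exchange_big /=.
have -> : \sum_(h in H) \sum_(u in K) coset_weight K h * chi (x * (h * u^-1))%g
  = \sum_(h in H) coset_weight K h *: (1 : k^o).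
  apply: eq_bigr => h Hh; rewrite -mulr_sumr; congr (_ * _).
  rewrite -[RHS](chiP (x * h)%g) ?groupM ?(subsetP sHX h) //.
  rewrite -(sum_invg (V := k^o) K (fun u => chi (x * h * u)%g)).
  by apply: eq_bigr => u _; rewrite mulgA.
rewrite coset_weight_sum // sumr_const card_ord -/(indexg _ _).
rewrite -(cardsE (mem (lcosets K H))) cardsE card_lcosets.
rewrite -[#|H : K|]odd_double_half oddHK natrD -mul2n natrM.
by rewrite (pcharf0 ch2) mul0r addr0.
Qed.

End Weights.

(** * Projective forms are relative traces *)

Section FormTraces.

Variables (k : fieldType) (gT : finGroupType).
Implicit Types (X H K : {group gT}).

(** The left action of X on Gram matrices: the form (u, v) |-> B(x^-1 u, x^-1 v)
    in terms of the left module structure of M. *)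
Definition twist X n (rM : mx_representation k X n) x (B : 'M[k]_n) : 'M[k]_n :=
  rM x *m B *m (rM x)^T.

Section Twist.

Variables (X : {group gT}) (n : nat) (rM : mx_representation k X n).
Implicit Types B : 'M[k]_n.

Definition inv_form (H : {set gT}) B : Prop :=
  {in H, forall h, twist rM h B = B}.

Lemma twistM x y B : x \in X -> y \in X ->
  twist rM (x * y)%g B = twist rM x (twist rM y B).
Proof. by move=> Xx Xy; rewrite /twist repr_mxM // trmx_mul !mulmxA. Qed.

Lemma tr_twist x B : (twist rM x B)^T = twist rM x B^T.
Proof. by rewrite /twist !trmx_mul trmxK mulmxA. Qed.

Lemma twist_sum (I : finType) (P : pred I) x (F : I -> 'M[k]_n) :
  twist rM x (\sum_(i | P i) F i) = \sum_(i | P i) twist rM x (F i).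
Proof. by rewrite /twist mulmx_sumr mulmx_suml. Qed.

Lemma twistZ x a B : twist rM x (a *: B) = a *: twist rM x B.
Proof. by rewrite /twist -scalemxAr -scalemxAl. Qed.

Lemma rinv_twist H B : H \subset X -> inv_form H B ->
  rinv (V := 'M[k]_n) H X (fun x => twist rM x B).
Proof.
by move=> sHX BH x h Xx Hh; rewrite twistM ?(subsetP sHX h) // BH.
Qed.

Lemma inv_formS H K B : K \subset H -> inv_form H B -> inv_form K B.
Proof. by move=> /subsetP sKH BH h /sKH; apply: BH. Qed.

(** B is a homomorphism from M to its dual. *)
Lemma inv_formM x B : inv_form X B -> x \in X ->
  rM x *m B = B *m (rM x^-1%g)^T.
Proof.
move=> BX Xx; rewrite -{2}[B](BX x) // /twist -!mulmxA -trmx_mul.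
by rewrite -repr_mxM ?groupV // mulVg repr_mx1 trmx1 mulmx1.
Qed.

Lemma inv_form_sum H chi B : H \subset X -> weight H X chi -> inv_form H B ->
  inv_form X (\sum_(x in X) chi x *: twist rM x B).
Proof.
move=> sHX chiP BH y Xy; rewrite twist_sum.
transitivity (\sum_(x in X) chi (y^-1 * x)%g *: twist rM x B).
  rewrite -[RHS](sum_mulgl (V := 'M[k]_n) _ Xy); apply: eq_bigr => x Xx.
  by rewrite twistZ mulKg twistM.
apply: (weight_indep sHX) => //; last exact: rinv_twist.
move=> x Xx; rewrite -[RHS](chiP (y^-1 * x)%g) ?groupM ?groupV //.
by apply: eq_bigr => h _; rewrite mulgA.
Qed.

End Twist.

(** A possibly degenerate invariant form B' on L is the restriction to L of a
    regular form on L + L^*, with Gram matrix [B', 1; 1, 0]. Relative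
    projectivity therefore asks for B to be a relative trace of a form on which
    no regularity is imposed. *)
Lemma embed_in_regular H X n (rM : mx_representation k X n) (B' : 'M[k]_n) :
    H \subset X -> B'^T = B' -> inv_form rM H B' ->
  exists (rL : mx_representation k H (n + n)) (BL : 'M[k]_(n + n))
         (phi : 'M[k]_(n, n + n)),
    [/\ X_form rL BL, {in H, forall h, phi *m rL h = rM h *m phi}
      & phi *m BL *m phi^T = B'].
Proof.
move=> sHX symB BH; pose rH := subg_repr rM sHX.
pose rL := MxRepresentation (add_mx_repr (Representation rH)
                                         (Representation (dual_repr rH))).
exists rL, (block_mx B' 1%:M 1%:M 0), (row_mx 1%:M 0).
have rLE h : rL h = block_mx (rM h) 0 0 (rM h^-1%g)^T by [].
split; last 2 first.
- move=> h _; rewrite rLE mul_row_block mul_mx_row.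
  by rewrite !(mulmx1, mulmx0, mul1mx, mul0mx, addr0).
- rewrite mul_row_block tr_row_mx mul_row_col trmx1 trmx0.
  by rewrite !(mulmx1, mulmx0, mul1mx, mul0mx, addr0).
split; first by rewrite tr_block_mx !trmx1 trmx0 symB.
- suffices /mulmx1_unit[] : block_mx B' 1%:M 1%:M 0 *m block_mx 0 1%:M 1%:M (- B')
    = 1%:M by [].
  rewrite mulmx_block !(mulmx1, mulmx0, mul1mx, mul0mx, addr0, add0r) subrr.
  by rewrite -scalar_mx_block.
move=> h Hh; have Xh := subsetP sHX h Hh.
rewrite rLE tr_block_mx !trmxK !trmx0 !mulmx_block.
rewrite !(mulmx1, mulmx0, mul1mx, mul0mx, addr0, add0r).
rewrite -/(twist rM h B') BH // -trmx_mul -!repr_mxM ?groupV //.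
by rewrite !mulgV repr_mx1 trmx1.
Qed.

(** If phi : M -> L pulls the form of L back to B', then the homomorphism
    M -> Ind L with components phi t^-1, for t the representatives of the cosets
    of H, pulls the induced form back to Tr_H(B'). *)
Lemma form_projectiveI H X n (rM : mx_representation k X n) B B' chi :
    H \subset X -> weight H X chi -> B'^T = B' -> inv_form rM H B' ->
    B = \sum_(x in X) chi x *: twist rM x B' -> B \in unitmx ->
  form_projective rM B H.
Proof.
move=> sHX chiP symB BH defB uB; split=> //.
  split=> //; last by rewrite defB; exact: (inv_form_sum sHX chiP BH).
  rewrite defB raddf_sum /=; apply: eq_bigr => x _.
  by rewrite linearZ /= tr_twist symB.
have [rL [BL [phi [BLf phiH phiB]]]] := embed_in_regular sHX symB BH.
exists (n + n)%N, rL, BL; split=> //.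
have lX i : @lrep _ X H i \in X by apply: lrep_mem.
exists (\mxrow_i (rM (@lrep _ X H i) *m phi)).
  move=> g Xg; rewrite /= mul_mxrow mul_mxrow_mxblock.
  apply/eq_mxrowP => j /=; have [i Hi] := lrep_ex j Xg.
  rewrite (bigD1 i) //= big1 ?addr0 => [|i' ne_i].
    rewrite -[((lrep i)^-1 * g * _)%g]mulgA Hi -mulmxA phiH // !mulmxA.
    rewrite -!repr_mxM ?groupM ?groupV //.
    by rewrite mulKVg.
  rewrite -[((lrep i')^-1 * g * _)%g]mulgA.
  case Hi': ((_^-1 * (g * _))%g \in H); last by rewrite mulmx0.
  by rewrite (lrep_uniq Hi' Hi) eqxx in ne_i.
rewrite defB (weight_indep sHX chiP (@coset_weightP _ _ H X) (rinv_twist sHX BH)).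
rewrite coset_weight_sum // /ind_form mul_mxrow_mxdiag tr_mxrow mul_mxrow_mxcol.
apply: eq_bigr => i _; rewrite /twist -phiB trmx_mul !mulmxA //.
Qed.

(** The coset of H itself singles out the component L of the induced module;
    the pull-back of its form along M -> Ind L -> L has trace B. *)
Lemma form_projectiveE H X n (rM : mx_representation k X n) B chi :
    form_projective rM B H -> weight H X chi ->
  exists B', [/\ B'^T = B', inv_form rM H B'
               & B = \sum_(x in X) chi x *: twist rM x B'].
Proof.
case=> [Bf sHX [m [rL [BL [[symL _ BLH] [f fX fB]]]]]] chiP.
(* lrep i0 is the representative of the coset H, which is some element of H. *)
have [i0 Hi0 _] := lrepP H (group1 X).
have lX i : @lrep _ X H i \in X by apply: lrep_mem.
have l0H : @lrep _ X H i0 \in H by rewrite -groupV -[(_^-1)%g]mulg1.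
pose phi := submxrow f i0 *m rL (lrep i0)^-1%g.
have fE i g h : g \in X -> h \in H -> (@lrep _ X H i * h = g)%g ->
    rM g *m phi = submxrow f i *m rL h.
  move=> Xg Hh def_g; rewrite /phi mulmxA.
  have -> : rM g *m submxrow f i0 = submxrow f i *m rL (h * lrep i0)%g.
    rewrite mul_submxrow fX //= -{1}[f]submxrowK mul_mxrow_mxblock mxrowK.
    have def_h : ((lrep i)^-1 * g * lrep i0 = h * lrep i0)%g.
      by rewrite -def_g mulKg.
    rewrite (bigD1 i) //= big1 ?addr0 => [|i' ne_i].
      by rewrite def_h groupM.
    case: ifP => [Hi'|]; last by rewrite mulmx0.
    rewrite groupMr // -def_g in Hi'.
    case/eqP: ne_i; apply: (lrep_uniq Hi').
    by rewrite mulKg.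
  by rewrite -mulmxA -repr_mxM ?groupV ?groupM // mulgK.
have phiH : {in H, forall h, rM h *m phi = phi *m rL h}.
  move=> h Hh; rewrite (fE i0 h ((lrep i0)^-1 * h)%g) ?groupM ?groupV ?mulKVg //.
    by rewrite repr_mxM ?groupV // mulmxA.
  exact: (subsetP sHX).
have phil i : rM (lrep i) *m phi = submxrow f i.
  by rewrite (fE i (lrep i) 1%g) ?mulg1 ?group1 // repr_mx1 mulmx1.
clearbody phi => {fE}.
have phiBH : inv_form rM H (phi *m BL *m phi^T).
  move=> h Hh; rewrite /twist !mulmxA phiH // -mulmxA -trmx_mul phiH //.
  rewrite trmx_mul !mulmxA; congr (_ *m phi^T).
  by rewrite -{2}(BLH h Hh) !mulmxA.
exists (phi *m BL *m phi^T); split=> //.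
  by rewrite !trmx_mul trmxK symL mulmxA.
rewrite (weight_indep sHX chiP (@coset_weightP _ _ H X) (rinv_twist sHX phiBH)).
rewrite coset_weight_sum // -fB -{1 2}[f]submxrowK /ind_form.
rewrite mul_mxrow_mxdiag tr_mxrow mul_mxrow_mxcol.
by apply: eq_bigr => i _; rewrite /twist -phil trmx_mul !mulmxA.
Qed.

End FormTraces.

(** * Sums in characteristic 2 *)

Section CharTwoSums.

Variables (k : fieldType) (char2 : 2%N \in [pchar k]).

(** The off-diagonal terms cancel in pairs. *)
Lemma double_sum_sym (I : finType) (A : {set I}) (F : I -> I -> k) :
    {in A &, forall i j, F i j = F j i} ->
  \sum_(i in A) \sum_(j in A) F i j = \sum_(i in A) F i i.
Proof.
elim: {A}_.+1 {-2}A (ltnSn #|A|) => // m IHm A leAm symF.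
have [-> | [i0 Ai0]] := set_0Vmem A; first by rewrite !big_set0.
have notin0 : i0 \notin A :\ i0 by rewrite !inE eqxx.
rewrite -(setD1K Ai0) !(big_setU1 _ notin0) /=.
have symA' : {in A :\ i0 &, forall i j, F i j = F j i}.
  by move=> i j /setD1P[_ Ai] /setD1P[_ Aj]; apply: symF.
have ltA'm : (#|A :\ i0| < m)%N by rewrite (cardsD1 i0) Ai0 in leAm.
rewrite [X in _ + X](eq_bigr (fun i => F i0 i + \sum_(j in A :\ i0) F i j)).
  rewrite big_split /= (IHm _ ltA'm symA') addrA -[F i0 i0 + _ + _]addrA.
  by rewrite addrr_pchar2 // addr0.
by move=> i /setD1P[_ Ai]; rewrite (big_setU1 _ notin0) /= symF.
Qed.

(** The orbits of P that are not fixed points have even length. *)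
Lemma fixed_points_sum (aT : finGroupType) (rT : finType)
    (to : {action aT &-> rT}) (P : {group aT}) (S : {set rT}) (f : rT -> k) :
    2.-group P -> [acts P, on S | to] ->
    {in P & S, forall p s, f (to s p) = f s} ->
  \sum_(s in S) f s = \sum_(s in 'Fix_(S | to)(P)) f s.
Proof.
move=> p2 actsP fP; have partS := orbit_partition actsP.
rewrite (set_partition_big _ partS) /=.
rewrite [RHS](eq_bigl (fun s => (s \in S) && (s \in 'Fix_to(P)))); last first.
  by move=> s; rewrite inE.
rewrite big_mkcondr (set_partition_big _ partS) /=.
apply: eq_bigr => _ /imsetP[x Sx ->].
have fx y : y \in orbit to P x -> f y = f x.
  by case/orbitP=> p Pp <-; rewrite fP.
have [Fx | nFx] := boolP (x \in 'Fix_to(P)).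
  by move/orbit1P: (Fx) => ->; rewrite !big_set1 Fx.
rewrite [RHS]big1 => [|y Oy]; last first.
  case: ifP => // Fy; case/negP: nFx.
  move/orbit1P: (Fy) => Oy1; rewrite orbit_sym Oy1 in Oy.
  by rewrite -(set1P Oy) in Fy *.
rewrite (eq_bigr (fun _ => f x) fx) sumr_const.
have : (2.-nat #|orbit to P x|)%N.
  by rewrite card_orbit; apply: pnat_dvd (dvdn_indexg _ _) p2.
case/p_natP=> [[|m] cardO]; last first.
  by rewrite cardO expnS mulnC mulrnA (mulrn_pchar char2).
case/negP: nFx; apply/orbit1P/esym/eqP; rewrite eqEcard sub1set orbit_refl.
by rewrite cardO cards1.
Qed.

End CharTwoSums.

(** * Class sums as relative traces from extended centralizers *)

Section RealClasses.

Variables (k : fieldType) (gT : finGroupType).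
Implicit Types (X H : {group gT}) (a : gT).

(** The union of the X-classes of a and a^-1: the orbit of a under the action
    of X combined with inversion. *)
Definition rclass X a : {set gT} := (a ^: X) :|: (a^-1 ^: X)%g.

Lemma mem_set2V a b : (b^-1%g \in [set a; a^-1%g]) = (b \in [set a; a^-1%g]).
Proof. by rewrite !inE orbC (inj_eq invg_inj) (can2_eq invgK invgK). Qed.

Lemma mem_ext_centralizer X a b h : h \in X -> b \in [set a; a^-1%g] ->
  (h \in ext_centralizer X a) = ((b ^ h)%g \in [set a; a^-1%g]).
Proof.
move=> Xh /set2P Db.
have -> : (h \in ext_centralizer X a) = (h^-1 \in ext_centralizer X a)%g.
  by rewrite -(groupV (ext_centralizer_group X a)).
rewrite inE groupV Xh invgK -mulgA -conjgE.
by case: Db => -> //; rewrite conjVg mem_set2V.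
Qed.

Lemma ext_centralizer_sub X a : ext_centralizer X a \subset X.
Proof. by apply/subsetP=> x; rewrite inE => /andP[]. Qed.

Lemma ext_centralizer_stable X a h s : h \in ext_centralizer X a ->
  ((s ^ h)%g \in [set a; a^-1%g]) = (s \in [set a; a^-1%g]).
Proof.
move=> Hh; have Xh := subsetP (ext_centralizer_sub X a) h Hh.
have [As|nAs] := boolP (s \in [set a; a^-1%g]).
  by rewrite -(mem_ext_centralizer Xh As).
apply: contraNF nAs => Ash; rewrite -[s](conjgK h).
by rewrite -(@mem_ext_centralizer X _ _ h^-1%g _ Ash) ?groupV.
Qed.

Lemma rclassP X a g :
  reflect (exists2 x, x \in X & (g ^ x)%g \in [set a; a^-1%g]) (g \in rclass X a).
Proof.
apply: (iffP setUP) => [[] /imsetP[x Xx ->]|[x Xx /set2P Eg]].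
- by exists x^-1%g; rewrite ?groupV // conjgK set21.
- by exists x^-1%g; rewrite ?groupV // conjgK set22.
rewrite -[g](conjgK x).
by case: Eg => ->; [left | right]; rewrite memJ_class ?groupV.
Qed.

Lemma rclass_refl X a : a \in rclass X a.
Proof. by apply/setUP; left; apply: class_refl. Qed.

Lemma rclassJ X a g x : x \in X -> ((g ^ x)%g \in rclass X a) = (g \in rclass X a).
Proof.
move=> Xx; apply/rclassP/rclassP=> [] [y Xy Ey].
  by exists (x * y)%g; rewrite ?groupM // conjgM.
by exists (x^-1 * y)%g; rewrite ?groupM ?groupV // conjgM conjgK.
Qed.

Lemma rclassV X a g : (g^-1%g \in rclass X a) = (g \in rclass X a).
Proof.
by apply/rclassP/rclassP=> [] [y Xy Ey]; exists y => //; move: Ey; rewrite conjVg mem_set2V.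
Qed.

(** The elements x of X that bring a or a^-1 to a given g in the orbit form one
    coset of the extended centralizer of a, over which chi sums to 1. *)
Lemma rclass_sum (V : lmodType k) X a chi (F : gT -> V) :
    weight (ext_centralizer_group X a) X chi ->
  \sum_(s in rclass X a) F s
  = \sum_(x in X) chi x *: \sum_(s in [set a; a^-1%g]) F (s ^ x^-1)%g.
Proof.
move=> chiP.
transitivity (\sum_(x in X) \sum_(g in rclass X a | (g ^ x)%g \in [set a; a^-1%g])
                chi x *: F g).
  rewrite [RHS](exchange_big_dep (fun g => g \in rclass X a)) /=; last first.
    by move=> x g _ /andP[].
  apply: eq_bigr => g Xg; rewrite Xg -scaler_suml -[LHS]scale1r; congr (_ *: _).
  have [y Xy Ey] := rclassP X a g Xg.
  rewrite -(chiP y Xy) [RHS](reindex_inj (mulgI y)) /=; apply: eq_bigl => h.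
  rewrite groupMl //; case Xh: (h \in X); last first.
    by rewrite !inE Xh.
  by rewrite (mem_ext_centralizer Xh Ey) conjgM.
apply: eq_bigr => x Xx; rewrite scaler_sumr.
rewrite (reindex_inj (conjg_inj x^-1)%g) /=; apply: eq_bigl => s.
rewrite conjgKV rclassJ ?groupV // andb_idl // => /set2P[]->; last rewrite rclassV.
  exact: rclass_refl.
exact: rclass_refl.
Qed.

End RealClasses.

(** * Supports of idempotents in characteristic 2 *)

Section Roots.

Variable gT : finGroupType.
Implicit Types (g s u v x : gT) (D : {set gT}).

(** The square root of an element of odd order inside the cyclic group that it
    generates. *)
Definition sqrt_odd s : gT := (s ^+ (#[s].+1./2))%g.

Lemma sqrt_mem (G : {group gT}) s : s \in G -> sqrt_odd s \in G.
Proof. exact: groupX. Qed.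

Lemma sqrt_oddK s : odd #[s] -> (sqrt_odd s * sqrt_odd s = s)%g.
Proof.
move=> os; rewrite /sqrt_odd -expgD addnn.
have /eqP -> : (#[s].+1./2.*2 == #[s].+1)%N.
  by rewrite -[X in _ == X](odd_double_half #[s].+1) /= os.
by rewrite expgS expg_order mulg1.
Qed.

Lemma sqrt_oddJ s x : (sqrt_odd (s ^ x) = sqrt_odd s ^ x)%g.
Proof. by rewrite /sqrt_odd orderJ conjXg. Qed.

Lemma sqrt_oddV s : (sqrt_odd s^-1 = (sqrt_odd s)^-1)%g.
Proof. by rewrite /sqrt_odd orderV expgVn. Qed.

Lemma sqrt_odd_odd s : odd #[s] -> odd #[sqrt_odd s].
Proof. by move=> os; apply: dvdn_odd os; apply: orderXdvd. Qed.

Lemma iter_sqrt_oddJ n s x :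
  (iter n sqrt_odd (s ^ x) = iter n sqrt_odd s ^ x)%g.
Proof. by elim: n => //= n ->; rewrite sqrt_oddJ. Qed.

Lemma iter_sqrt_oddV n s :
  (iter n sqrt_odd s^-1 = (iter n sqrt_odd s)^-1)%g.
Proof. by elim: n => //= n ->; rewrite sqrt_oddV. Qed.

Lemma iter_sqrt_oddK n s : odd #[s] ->
  ((iter n sqrt_odd s) ^+ (2 ^ n) = s)%g /\ odd #[iter n sqrt_odd s].
Proof.
move=> os; elim: n => [|n [IHn IHo]] /=; first by rewrite expg1.
split; last exact: sqrt_odd_odd.
by rewrite expnS expgM expgS expg1 sqrt_oddK.
Qed.

End Roots.

Section IdempotentSupport.

Variables (k : fieldType) (char2 : 2%N \in [pchar k]) (gT : finGroupType).
Variables (D : {group gT}) (a : gT -> k) (u : gT).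
Hypotheses (aJ : {in D &, forall g x, a (g ^ x)%g = a g})
  (aM : {in D, forall g, a g = \sum_(h in D) a h * a (h^-1 * g)%g})
  (uD : {in D, forall x, (u ^ x)%g = u}).

(** Sums over the 2^n-th roots of u arise from the coefficient a (u * v ^+ (2 ^ n))
    by writing the idempotent a as its own 2^n-th power. *)
Definition root_sum n v : k :=
  \sum_(g in D | (g ^+ (2 ^ n))%g == u) a (g * v)%g.

(** Write a (g * v ^+ 2) as a sum of products a (g1 * v) * a (g2 * v) with
    g = g1 * g2. The condition on g is symmetric in g1 and g2, because u is
    central, so that only the terms with g1 = g2 survive in characteristic 2. *)
Lemma root_sum_sqr n v : v \in D -> root_sum n (v * v)%g = root_sum n.+1 v ^+ 2.
Proof.
move=> Dv; rewrite /root_sum.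
transitivity (\sum_(g1 in D) \sum_(g2 in D)
   if ((g1 * g2) ^+ (2 ^ n) == u)%g then a (g1 * v)%g * a (g2 * v)%g else 0).
  transitivity (\sum_(g1 in D) \sum_(g in D)
     if (g ^+ (2 ^ n) == u)%g then a (g1 * v)%g * a ((g1 * v)^-1 * (g * (v * v)))%g
     else 0).
    rewrite exchange_big /= big_mkcondr /=; apply: eq_bigr => g Dg.
    case: ifP => _; last by rewrite big1.
    rewrite aM ?groupM //.
    by rewrite -(sum_mulgr (V := k^o) _ Dv).
  apply: eq_bigr => g1 Dg1; rewrite -(sum_mulgl (V := k^o) _ Dg1).
  apply: eq_bigr => g2 Dg2; case: ifP => // _; congr (_ * _).
  rewrite -(@aJ (g2 * v)%g v) ?groupM // conjgE; congr a.
  by rewrite invMg !mulgA mulgKV.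
rewrite (@double_sum_sym _ char2) => [|g1 g2 Dg1 Dg2]; last first.
  rewrite mulrC; congr (if _ then _ else _).
  rewrite -(inj_eq (conjg_inj g1)) uD // conjXg.
  by congr (_ ^+ _ == u)%g; rewrite conjgE -mulgA mulKg.
rewrite big_mkcondr /=.
have -> (I : finType) (A : {set I}) (F : I -> k) : (\sum_(i in A) F i) ^+ 2
   = \sum_(i in A) F i ^+ 2.
  exact: (raddf_sum (pFrobenius_aut char2)).
apply: eq_bigr => g Dg; rewrite expnS expgM expgS expg1.
by case: ifP => _; rewrite ?expr2 ?mul0r.
Qed.

Lemma root_sum_iter n v : v \in D ->
  root_sum 0 (v ^+ (2 ^ n))%g = root_sum n v ^+ (2 ^ n).
Proof.
elim: n v => [|n IHn] v Dv; first by rewrite expg1 expr1.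
rewrite expnS expgM IHn ?groupX // expgS expg1 root_sum_sqr //.
by rewrite -exprM.
Qed.

Lemma root_sum0 v : u \in D -> root_sum 0 v = a (u * v)%g.
Proof.
move=> Du; rewrite /root_sum (bigD1 u) /=; last by rewrite Du expg1 eqxx.
by rewrite big1 ?addr0 // => g /andP[/andP[_ /eqP<-]]; rewrite expg1 eqxx.
Qed.

End IdempotentSupport.

Section Osima.

Variables (k : fieldType) (char2 : 2%N \in [pchar k]) (gT : finGroupType).
Variables (G : {group gT}) (a : gT -> k).
Hypotheses (aJ : {in G &, forall g x, a (g ^ x)%g = a g})
  (aM : {in G, forall g, a g = \sum_(h in G) a h * a (h^-1 * g)%g}).

(** Elements g of even order lie outside the support of an idempotent a of
    Z(kG). With u the 2-part of g, the convolution identity restricts to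
    'C_G[u], where u is central (the Brauer homomorphism); there a g is a
    power of a sum over roots u^(1/2^n), and no such roots exist for large n. *)
Lemma idempotent_support g : g \in G -> a g != 0 -> odd #[g].
Proof.
move=> Gg; apply: contraR => even_g.
pose u := (g.`_2)%g; pose v := (g.`_(2%N)^')%g; pose D := 'C_G[u]%G.
have Gu : u \in G by rewrite groupX.
have Gv : v \in G by rewrite groupX.
have cuv : commute u v by apply: (commuteX2 _ _ (commute_refl g)).
have def_g : g = (u * v)%g by rewrite /u /v consttC.
have Du : u \in D by rewrite inE Gu cent1id.
have Dv : v \in D by rewrite inE Gv; apply/cent1P.
have ov : odd #[v].
  by rewrite odd_2'nat; apply: p_elt_constt.
have u1 : u != 1%g.
  apply: contra even_g => /eqP u1; rewrite def_g u1 mul1g //.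
have sDG : D \subset G by apply: subsetIl.
have uD : {in D, forall x, (u ^ x)%g = u}.
  by move=> x /setIP[_ /cent1P cxu]; rewrite conjgE -cxu mulKg.
have aDJ : {in D &, forall g x, a (g ^ x)%g = a g}.
  by move=> y x /(subsetP sDG) Gy /(subsetP sDG) Gx; apply: aJ.
have aDM : {in D, forall g, a g = \sum_(h in D) a h * a (h^-1 * g)%g}.
  move=> y Dy; rewrite aM ?(subsetP sDG) //.
  rewrite (@fixed_points_sum _ char2 _ _ ('J)%act <[u]>%G G).
  - apply: eq_bigl => h; rewrite afixJ cent_cycle //.
  - exact: p_elt_constt.
  - by rewrite astabsJ cycle_subG (subsetP (normG G)).
  move=> p h /= /cycleP[i ->] Gh; rewrite aJ ?groupX //; congr (_ * _).
  have cyu : (y ^ (u ^+ i) = y)%g.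
    rewrite conjgE; have /setIP[_ /cent1P cyu] := Dy.
    by rewrite (commuteX i cyu) mulKg.
  rewrite -{1}cyu -conjVg -conjMg aJ ?groupM ?groupX ?groupV //.
  exact: (subsetP sDG).
have Dsqrt n : iter n (@sqrt_odd gT) v \in D.
  by elim: n => //= n IHn; rewrite groupX.
rewrite def_g -(root_sum0 a v Du).
(* 2 ^ #|G| exceeds the 2-part of the order of every element of G. *)
have [E _] := iter_sqrt_oddK #|G| ov.
rewrite -E (root_sum_iter char2 aDJ aDM uD) // /root_sum big1 ?expr0n ?expn_eq0 //.
move=> y /andP[Dy /eqP Ey]; case/eqP: u1.
have Gy := subsetP sDG y Dy.
have p2u : 2.-elt u by apply: p_elt_constt.
apply/eqP; rewrite -order_eq1; apply/eqP.
have u_m : (#[u] %| #[y]`_(2%N)^')%N.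
  rewrite order_dvdn -Ey -expgM -order_dvdn -{1}[#[y]](partnC 2%N) ?order_gt0 //.
  rewrite dvdn_mul // p_part dvdn_exp2l //.
  apply: leq_trans (dvdn_leq (cardG_gt0 G) (order_dvdG Gy)).
  by apply: ltnW; rewrite ltn_logl ?order_gt0.
exact: pnat_1 p2u (pnat_dvd u_m (part_pnat _ _)).
Qed.

End Osima.

(** * Fitting's lemma *)

Section Fitting.

Variable k : fieldType.

(** Y lies in the bicommutant of z; this replaces membership of Y in k[z]. *)
Definition comm_with n (z Y : 'M[k]_n) : Prop :=
  forall W : 'M[k]_n, W *m z = z *m W -> W *m Y = Y *m W.

(** If 'X^m * q annihilates z and q.[0] != 0, then q(z) = 0 inverts z on the
    image of z ^+ m by a polynomial in z. *)
Lemma fitting n (z : 'M[k]_n) :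
  exists (m : nat) (Y : 'M[k]_n),
    [/\ comm_with z Y, z *m Y *m (z *m Y) = z *m Y
      & iter m (mulmx z) 1%:M *m (1%:M - z *m Y) = 0].
Proof.
case: n z => [|n] z.
  exists 0, 0; split=> [W _||]; rewrite !flatmx0 ?mul0mx //.
have [m [q nz_q0 def_p]] := multiplicity_XsubC (char_poly z) 0.
rewrite monic_neq0 ?char_poly_monic //= /root in nz_q0.
rewrite subr0 in def_p.
have [r def_q] : exists r, q = q.[0]%:P + 'X * r.
  have /factor_theorem[r Er] : root (q - q.[0]%:P) 0.
    by rewrite /root hornerD hornerN hornerC subrr.
  by exists r; rewrite -(subr0 'X) mulrC -Er addrC subrK.
pose y := - (q.[0])^-1 *: horner_mx z r.
have zm : z ^+ m.+1 * (1 - z * y) = 0.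
  have : horner_mx z (char_poly z) = 0 by apply: Cayley_Hamilton.
  rewrite def_p rmorphM rmorphXn /= horner_mx_X {1}def_q rmorphD rmorphM /=.
  rewrite horner_mx_X horner_mx_C => E.
  have -> : 1 - z * y = (q.[0])^-1 *: ((q.[0])%:M + z * horner_mx z r).
    rewrite scalerDr scale_scalar_mx mulVf // /y -scalerAr scaleNr opprK.
    by rewrite [RHS]addrC [LHS]addrC.
  rewrite exprS -mulrA -scalerAr.
  have czq : GRing.comm (z ^+ m) ((q.[0])%:M + z * horner_mx z r).
    apply/commr_sym/commrX/commr_sym/commrD.
      by rewrite /GRing.comm -!mulmxE scalar_mxC.
    apply: commrM => //; have := comm_horner_mx2 z 'X r.
    by rewrite horner_mx_X.
  by rewrite czq E scaler0 mulr0.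
have czy : GRing.comm z y.
  rewrite /GRing.comm /y -scalerAl -scalerAr; congr (_ *: _).
  by have := comm_horner_mx2 z 'X r; rewrite horner_mx_X.
pose Y := z ^+ m * y ^+ m.+1.
have zY : z * Y = (z * y) ^+ m.+1 by rewrite /Y mulrA -exprS exprMn_comm.
have zmE j : z ^+ m.+1 * (z * y) ^+ j = z ^+ m.+1.
  elim: j => [|j IHj]; first by rewrite mulr1.
  rewrite [(z * y) ^+ _]exprSr mulrA IHj; apply/esym/eqP.
  by rewrite -subr_eq0 -{1}[z ^+ _]mulr1 -mulrBr zm.
have fE : z * Y * (z * Y) = z * Y.
  have wE : (z * y) ^+ m.+1 = y ^+ m.+1 * z ^+ m.+1.
    by rewrite czy exprMn_comm.
  by rewrite zY {1}wE -mulrA zmE -wE.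
exists m.+1, Y; split=> //.
  move=> W cWz; have cWy : GRing.comm W y.
    rewrite /GRing.comm /y -scalerAl -scalerAr; congr (_ *: _).
    exact: comm_mx_horner.
  by apply: commrM; apply: commrX.
have -> : iter m.+1 (mulmx z) 1%:M = z ^+ m.+1.
  by elim: (m.+1) => // j IHj; rewrite exprS -IHj.
by rewrite mulmxE zY mulrBr mulr1 zmE subrr.
Qed.

End Fitting.

Section Indecomposable.

Variables (k : fieldType) (gT : finGroupType) (X : {group gT}) (n : nat).
Variables (rM : mx_representation k X n) (indM : mx_indecomposable rM).

Definition endo (A : 'M[k]_n) : Prop := {in X, forall x, rM x *m A = A *m rM x}.

Lemma endo_module A : endo A -> mxmodule rM A.
Proof. by move=> eA; apply/mxmoduleP=> x Xx; rewrite -eA // submxMl. Qed.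

Lemma indec_idempotent f : endo f -> f *m f = f -> f = 0 \/ f = 1%:M.
Proof.
move=> ef ff; have eg : endo (1%:M - f).
  by move=> x Xx; rewrite mulmxBl mulmxBr mul1mx mulmx1 ef.
have fg0 : (1%:M - f) *m f = 0 by rewrite mulmxBl mul1mx ff subrr.
have [| |->|/eqP] := indM.2 _ _ (endo_module ef) (endo_module eg).
- apply/eqmxP; rewrite submx1 /=.
  have -> : 1%:M = f + (1%:M - f) :> 'M_n by rewrite addrC subrK.
  by rewrite {2}addrC addrK addmx_sub_adds.
- apply/eqP; rewrite -submx0; apply/rV_subP=> v; rewrite sub_capmx.
  case/andP=> /submxP[u ->] /submxP[w E].
  by rewrite -ff mulmxA E -mulmxA fg0 mulmx0 sub0mx.
- by left.
by rewrite subr_eq0 => /eqP; right.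
Qed.

Lemma indec_unit_nilp A : endo A ->
  A \in unitmx \/ exists m, iter m (mulmx A) 1%:M = 0.
Proof.
move=> eA; have [m [Y [cY ff zm]]] := fitting A.
have eY : endo Y by move=> x Xx; apply: cY; rewrite eA.
have eAY : endo (A *m Y).
  by move=> x Xx; rewrite -(mulmxA A Y) -eY // !mulmxA eA.
have [f0|f1] := indec_idempotent eAY ff.
  by right; exists m; rewrite f0 subr0 mulmx1 in zm.
by left; case: (mulmx1_unit f1).
Qed.

(** If T = (A + B)^-1 and T A is not invertible, then T A is nilpotent by
    Fitting's lemma, and the geometric series inverts T B = 1 - T A. *)
Lemma indec_add_unit A B : endo A -> endo B -> A + B \in unitmx ->
  A \in unitmx \/ B \in unitmx.
Proof.
move=> eA eB uS; pose T := invmx (A + B).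
have eT : endo T.
  move=> x Xx; apply: (can_inj (mulKmx uS)); apply: (can_inj (mulmxK uS)).
  rewrite -!mulmxA mulVmx // mulmx1 !mulmxA mulmxV // mul1mx.
  by rewrite mulmxDl mulmxDr eA ?eB.
have eTA : endo (T *m A).
  by move=> x Xx; rewrite -(mulmxA T A) -eA // !mulmxA eT.
have [|[m nilA]] := indec_unit_nilp eTA.
  by rewrite unitmx_mul => /andP[_]; left.
right; have TB : T *m B = 1%:M - T *m A.
  by rewrite -(mulVmx uS) -/T mulmxDr addrC addKr.
suffices /mulmx1_unit[] : T *m B *m \sum_(i < m) iter i (mulmx (T *m A)) 1%:M = 1%:M.
  by rewrite unitmx_mul => /andP[].
transitivity (1%:M - iter m (mulmx (T *m A)) 1%:M); last by rewrite nilA subr0.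
rewrite TB; elim: m {nilA} => [|m IHm]; first by rewrite big_ord0 mulmx0 subrr.
rewrite big_ord_recr /= mulmxDr IHm mulmxBl mul1mx.
by rewrite addrA subrK.
Qed.

End Indecomposable.

(** * The centre of the group algebra *)

Section GroupAlgebra.

Variables (k : fieldType) (gT : finGroupType) (G : {group gT}).
Local Notation aG := (regular_repr k G).
Local Notation R_G := (group_ring k G).
Local Notation gi := (gring_index G).
Implicit Types A B : 'M[k]_#|G|.

Lemma gi_eq x y : x \in G -> y \in G -> (gi x == gi y) = (x == y).
Proof. by move=> Gx Gy; rewrite -(inj_eq enum_val_inj) !gring_indexK. Qed.

Lemma sum_gring (V : nmodType) (F : gT -> V) :
  \sum_(i < #|G|) F (enum_val i) = \sum_(x in G) F x.
Proof. by rewrite [RHS]big_enum_val. Qed.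

Lemma mxG_eq m (M N : 'M[k]_(#|G|, m)) :
  {in G, forall x, row (gi x) M = row (gi x) N} -> M = N.
Proof.
move=> eqMN; apply/row_matrixP=> i.
by rewrite -(gring_valK i) eqMN ?enum_valP.
Qed.

Lemma row_bireg p x : p \in setX G G -> x \in G ->
  row (gi x) (bireg_mx k G p) = gbasis k G (p.1^-1 * x * p.2)%g.
Proof. by move=> _ Gx; rewrite rowK gring_indexK. Qed.

Lemma bireg_regular y : bireg_mx k G (1%g, y) = aG y.
Proof. by apply/row_matrixP=> i; rewrite !rowK /= invg1 mul1g. Qed.

Lemma gring_mxE n (rM : mx_representation k G n) (v : 'rV_#|G|) :
  gring_mx rM v = \sum_(x in G) v 0 (gi x) *: rM x.
Proof.
rewrite /gring_mx /= mulmx_sum_row linear_sum /= -sum_gring.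
by apply: eq_bigr => i _; rewrite linearZ /= rowK mxvecK gring_valK.
Qed.

Lemma gring_op_sum n (rM : mx_representation k G n) A :
  gring_op rM A = \sum_(x in G) gcoef A x *: rM x.
Proof. by rewrite gring_opE gring_mxE. Qed.

Lemma group_ringE A : (A \in R_G)%MS -> A = \sum_(x in G) gcoef A x *: aG x.
Proof.
case/envelop_mxP=> f ->; rewrite -[RHS](@gring_op_sum _ aG).
rewrite linear_sum /=; apply: eq_bigr => x Gx.
by rewrite linearZ /= gring_opG.
Qed.

Lemma sum_group_ring (f : gT -> k) : (\sum_(x in G) f x *: aG x \in R_G)%MS.
Proof. by apply/envelop_mxP; exists f. Qed.

Lemma gring_mx_mem v : (gring_mx aG v \in R_G)%MS.
Proof. by rewrite gring_mxE (sum_group_ring (fun x => v 0 (gi x))). Qed.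

Lemma regular_comm_bireg A x : (A \in R_G)%MS -> x \in G ->
  A *m bireg_mx k G (x, 1%g) = bireg_mx k G (x, 1%g) *m A.
Proof.
move=> /group_ringE-> Gx; rewrite mulmx_suml mulmx_sumr; apply: eq_bigr => y Gy.
by rewrite -scalemxAl -scalemxAr bireg_mx_regC.
Qed.

Lemma row_gring A x : x \in G ->
  A *m bireg_mx k G (x^-1%g, 1%g) = bireg_mx k G (x^-1%g, 1%g) *m A ->
  row (gi x) A = gring_row A *m bireg_mx k G (x^-1%g, 1%g).
Proof.
move=> Gx cA; rewrite /gring_row rowE [row _ A]rowE -mulmxA cA mulmxA.
by rewrite -[delta_mx 0 (gi 1) *m _]rowE row_bireg ?inE ?groupV ?group1 ?Gx //
  invgK !mulg1.
Qed.

Lemma bireg_entry p x y : p \in setX G G -> x \in G -> y \in G ->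
  bireg_mx k G p (gi x) (gi y) = (p.1^-1 * x * p.2 == y)%g%:R.
Proof.
case: p => u v; rewrite inE /= => /andP[Gu Gv] Gx Gy.
by rewrite mxE gring_indexK // mxE /= gi_eq ?groupM ?groupV // eq_sym.
Qed.

Lemma gring_entry A x y : (A \in R_G)%MS -> x \in G -> y \in G ->
  A (gi x) (gi y) = gcoef A (x^-1 * y)%g.
Proof.
move=> RA Gx Gy.
have -> : A (gi x) (gi y) = row (gi x) A 0 (gi y) by rewrite mxE.
rewrite row_gring ?regular_comm_bireg ?groupV // mxE /gcoef.
rewrite (bigD1 (gi (x^-1 * y)%g)) //= big1 ?addr0 => [|i ne_i].
  rewrite bireg_entry ?inE ?groupM ?groupV ?Gx ?group1 //=.
  by rewrite invgK mulg1 mulKVg eqxx mulr1.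
rewrite -(gring_valK i) bireg_entry ?inE ?groupV ?Gx ?group1 ?enum_valP //=.
rewrite invgK mulg1; case: eqP => [def_y|]; last by rewrite mulr0.
by case/eqP: ne_i; rewrite -def_y mulKg gring_valK.
Qed.

(** Left multiplications and right multiplications centralise each other. *)
Lemma comm_bireg_group_ring A :
  {in G, forall x, A *m bireg_mx k G (x, 1%g) = bireg_mx k G (x, 1%g) *m A} ->
  (A \in R_G)%MS.
Proof.
move=> cA; suffices -> : A = gring_mx aG (gring_row A) by apply: gring_mx_mem.
apply: mxG_eq => x Gx; rewrite !row_gring ?cA ?groupV ?gring_mxK //.
by rewrite regular_comm_bireg ?groupV ?gring_mx_mem.
Qed.

Lemma bireg_split p : p \in setX G G ->
  bireg_mx k G p = bireg_mx k G (p.1, 1%g) *m aG p.2.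
Proof. by case: p => x y; rewrite inE /= => /andP[Gx Gy]; apply: bireg_mx_reg. Qed.

(** Bimodule endomorphisms of kG are multiplications by central elements. *)
Lemma center_bireg A :
  (A \in 'Z(R_G))%MS <->
  {in setX G G, forall p, A *m bireg_mx k G p = bireg_mx k G p *m A}.
Proof.
split=> [/center_mxP[RA cA] p Gp | cA].
  have [Gx Gy] : p.1 \in G /\ p.2 \in G by apply/andP; rewrite -in_setX; case: p Gp.
  rewrite bireg_split // mulmxA regular_comm_bireg // -!mulmxA.
  by rewrite cA ?envelop_mx_id.
apply/center_mxP; split.
  by apply: comm_bireg_group_ring => x Gx; rewrite cA // inE /= Gx group1.
move=> B /group_ringE->; rewrite mulmx_suml mulmx_sumr; apply: eq_bigr => x Gx.
by rewrite -scalemxAl -scalemxAr -bireg_regular cA // inE /= Gx group1.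
Qed.

Lemma gcoefM A B g : (B \in R_G)%MS -> g \in G ->
  gcoef (A *m B) g = \sum_(h in G) gcoef A h * gcoef B (h^-1 * g)%g.
Proof.
move=> RB Gg; rewrite /gcoef gring_row_mul mxE -sum_gring.
apply: eq_bigr => i _; rewrite gring_valK; congr (_ * _).
by rewrite -{1}(gring_valK i) gring_entry ?enum_valP.
Qed.

Lemma gcoefZ c A g : gcoef (c *: A) g = c * gcoef A g.
Proof. by rewrite /gcoef /gring_row !mxE. Qed.

Lemma gcoefG x g : x \in G -> g \in G -> gcoef (aG x) g = (x == g)%:R.
Proof.
by move=> Gx Gg; rewrite /gcoef !mxE gring_indexK // mul1g /= gi_eq // eq_sym.
Qed.

Lemma gcoef_sum (f : gT -> k) g : g \in G ->
  gcoef (\sum_(x in G) f x *: aG x) g = f g.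
Proof.
move=> Gg; transitivity (\sum_(x in G) gcoef (f x *: aG x) g).
  by rewrite /gcoef linear_sum summxE.
rewrite (bigD1 g) //= big1 => [|x /andP[Gx ne]].
  by rewrite gcoefZ gcoefG // eqxx mulr1 addr0.
by rewrite gcoefZ gcoefG // (negPf ne) mulr0.
Qed.

Lemma gset_mxE (C : {set gT}) : C \subset G ->
  gset_mx k G C = \sum_(x in G) (x \in C)%:R *: aG x.
Proof.
move=> sCG; rewrite /gset_mx big_mkcond [RHS]big_mkcond /=; apply: eq_bigr => x _.
case Cx: (x \in C); first by rewrite (subsetP sCG) // scale1r.
by rewrite scale0r if_same.
Qed.

Lemma centerJ A g x : (A \in 'Z(R_G))%MS -> g \in G -> x \in G ->
  gcoef A (g ^ x)%g = gcoef A g.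
Proof.
move=> /center_mxP[RA cA] Gg Gx; rewrite conjgE.
rewrite -(gring_entry RA Gx) ?groupM //.
have -> : gcoef A g = A (gi 1%g) (gi g) by rewrite gring_entry // invg1 mul1g.
pose E := aG x *m A.
have -> : A (gi x) (gi (g * x)%g) = E (gi 1%g) (gi (g * x)%g).
  rewrite /E; transitivity (row (gi 1) (aG x *m A) 0 (gi (g * x)%g)).
    2: by rewrite mxE.
  by rewrite row_mul -bireg_regular row_bireg ?inE ?group1 ?Gx //= invg1 !mul1g
    -rowE mxE.
rewrite /E cA ?envelop_mx_id // mxE.
rewrite (bigD1 (gi g)) //= big1 ?addr0 => [|i ne_i].
  by rewrite -bireg_regular bireg_entry ?inE ?groupM ?group1 ?Gx //= invg1 mul1g
    eqxx mulr1.
rewrite -(gring_valK i) -bireg_regular.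
rewrite bireg_entry ?inE ?groupM ?group1 ?Gx ?enum_valP //= invg1 mul1g.
case: eqP => [/mulIg E'|]; last by rewrite mulr0.
by case/eqP: ne_i; rewrite -E' gring_valK.
Qed.

Lemma tr_bireg p : p \in setX G G ->
  (bireg_mx k G p)^T = bireg_mx k G (p^-1)%g.
Proof.
move=> Gp; have Gp' : (p^-1)%g \in setX G G by rewrite groupV.
have [Gu Gv] : p.1 \in G /\ p.2 \in G by apply/andP; rewrite -in_setX; case: p Gp {Gp'}.
apply/matrixP=> i j; rewrite mxE -(gring_valK i) -(gring_valK j).
rewrite !bireg_entry ?enum_valP //=; congr (nat_of_bool _)%:R.
rewrite invgK; apply/eqP/eqP=> <-; rewrite !mulgA.
  by rewrite mulgV mul1g mulgK.
by rewrite mulVg mul1g mulgKV.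
Qed.

Lemma tr_regular x : x \in G -> (aG x)^T = aG x^-1%g.
Proof.
move=> Gx; rewrite -!bireg_regular tr_bireg ?inE /= ?group1 //.
by rewrite -[((1, x)^-1)%g]/((1^-1, x^-1)%g) invg1.
Qed.

Lemma group_ring_tr A : (A \in R_G)%MS -> (A^T \in R_G)%MS.
Proof.
move=> /group_ringE->; rewrite raddf_sum /=.
apply/envelop_mxP; exists (fun x => gcoef A x^-1%g).
rewrite -(sum_invg (V := 'M[k]_#|G|)); apply: eq_bigr => x Gx.
by rewrite linearZ /= tr_regular ?groupV // invgK.
Qed.

Lemma gcoef_tr A x : (A \in R_G)%MS -> x \in G -> gcoef A^T x = gcoef A x^-1%g.
Proof.
move=> RA Gx; have RAt := group_ring_tr RA.
rewrite -[x in LHS]mul1g -invg1 -gring_entry // mxE gring_entry //.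
by rewrite mulg1.
Qed.

Lemma center_tr A : (A \in 'Z(R_G))%MS -> (A^T \in 'Z(R_G))%MS.
Proof.
move/center_bireg=> cA; apply/center_bireg=> p Gp; apply: trmx_inj.
by rewrite !trmx_mul trmxK tr_bireg // cA ?groupV.
Qed.

Lemma center_mul A B :
  (A \in 'Z(R_G))%MS -> (B \in 'Z(R_G))%MS -> (A *m B \in 'Z(R_G))%MS.
Proof.
move=> /center_bireg cA /center_bireg cB; apply/center_bireg=> p Gp.
by rewrite -mulmxA cB // mulmxA cA // mulmxA.
Qed.

Lemma center_comm A B : (A \in 'Z(R_G))%MS -> (B \in 'Z(R_G))%MS -> A *m B = B *m A.
Proof. by case/center_mxP=> RA _ /center_mxP[_ ->]. Qed.

Lemma center1 : (1%:M \in 'Z(R_G))%MS.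
Proof. by apply/center_bireg=> p _; rewrite mul1mx mulmx1. Qed.

Lemma centerB A B : (A \in 'Z(R_G))%MS -> (B \in 'Z(R_G))%MS -> (A - B \in 'Z(R_G))%MS.
Proof.
move=> /center_bireg cA /center_bireg cB; apply/center_bireg=> p Gp.
by rewrite mulmxBl mulmxBr cA ?cB.
Qed.

Lemma contragredientK : contragredient_mx k G *m contragredient_mx k G = 1%:M.
Proof.
apply: mxG_eq => x Gx; rewrite row_mul rowK -rowE rowK !gring_indexK ?groupV //.
by rewrite invgK row1.
Qed.

(** The anti-automorphism g |-> g^-1 is the transposition of the matrices of
    right multiplications. *)
Lemma contragredient_tr A : (A \in 'Z(R_G))%MS ->
  A *m contragredient_mx k G = contragredient_mx k G *m A^T.
Proof.
move=> ZA; have [RA _] := center_mxP ZA.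
have cE x y : x \in G -> y \in G ->
    contragredient_mx k G (gi x) (gi y) = (x^-1 == y)%g%:R.
  by move=> Gx Gy; rewrite mxE gring_indexK // mxE /= gi_eq ?groupV // eq_sym.
apply/matrixP=> i j; rewrite -(gring_valK i) -(gring_valK j).
move: (enum_val i) (enum_val j) (enum_valP i) (enum_valP j) => x y Gx Gy.
rewrite !mxE (bigD1 (gi y^-1%g)) //= big1 ?addr0 => [|l ne_l]; last first.
  rewrite -(gring_valK l) cE ?enum_valP // -(inj_eq invg_inj) invgK.
  case: eqP => [E|]; last by rewrite mulr0.
  by case/eqP: ne_l; rewrite -E gring_valK.
rewrite cE ?groupV // invgK eqxx mulr1.
rewrite (bigD1 (gi x^-1%g)) //= big1 ?addr0 => [|l ne_l]; last first.
  rewrite -(gring_valK l) cE ?enum_valP //.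
  case: eqP => [E|]; last by rewrite mul0r.
  by case/eqP: ne_l; rewrite E gring_valK.
rewrite cE ?groupV // eqxx mul1r mxE !gring_entry ?groupV //.
have Gy' : (y^-1)%g \in G by rewrite groupV.
rewrite -[RHS](centerJ ZA _ Gy') ?groupM ?groupV //.
by rewrite conjgE invgK !mulgA mulgV mul1g.
Qed.

(** Two central idempotents that generate the same ideal are equal. *)
Lemma real_block_tr A : (A \in 'Z(R_G))%MS -> A *m A = A -> real_block A -> A^T = A.
Proof.
move=> ZA AA; rewrite /real_block contragredient_tr // => realA.
have [uS _] := mulmx1_unit contragredientK.
have {}realA : (A^T :=: A)%MS.
  by apply: eqmx_trans realA; apply: eqmx_sym; apply: eqmxMfull; rewrite row_full_unit.
have AAt : A^T *m A^T = A^T by rewrite -trmx_mul AA.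
have /submxP[U EU] : (A <= A^T)%MS by rewrite realA.
have /submxP[V EV] : (A^T <= A)%MS by rewrite realA.
have E1 : A *m A^T = A by rewrite {1}EU -mulmxA AAt -EU.
have E2 : A^T *m A = A^T by rewrite {1}EV -mulmxA AA -EV.
rewrite -{}E2 -[RHS]E1; have [_ cA] := center_mxP ZA; rewrite cA //.
by have /center_mxP[] := center_tr ZA.
Qed.

End GroupAlgebra.

(** * Real blocks and their defect classes *)

Section Block.

Variables (k : fieldType) (char2 : 2%N \in [pchar k]).
Variables (gT : finGroupType) (G : {group gT}) (e : 'M[k]_#|G|).
Hypothesis blockE : block_idempotent e.
Local Notation aG := (regular_repr k G).
Local Notation R_G := (group_ring k G).
Local Notation ZG := ('Z(R_G))%MS.

Lemma block_center : (e \in ZG)%MS. Proof. by case: blockE. Qed.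
Lemma block_idem : e *m e = e. Proof. by case: blockE. Qed.

(** Z(kG)e is local: by Fitting's lemma a central z outside the kernel of the
    central character of e is invertible in Z(kG)e. *)
Lemma block_local w z : central_character e w -> (z \in ZG)%MS -> w z != 0 ->
  exists Y, [/\ (Y \in ZG)%MS, z *m Y = e & e *m Y = Y].
Proof.
case=> wL wM w1 we Zz wz; have Ze := block_center.
have Zze := center_mul Zz Ze.
have [m [Y [cY ff zm]]] := fitting (z *m e).
have ZY : (Y \in ZG)%MS.
  move/center_bireg: Zze => cze; apply/center_bireg=> p Gp.
  by apply/esym/cY/esym/cze.
have ef : e *m (z *m e *m Y) = z *m e *m Y.
  by rewrite mulmxA; congr (_ *m Y); rewrite (center_comm Ze Zze) -mulmxA block_idem.
have Zf := center_mul Zze ZY; pose f := z *m e *m Y; rewrite -/f in ff ef zm Zf.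
have fe : f *m e = f by rewrite (center_comm Zf Ze).
case: blockE => _ _ _ /(_ f (e - f))[] //.
- exact: centerB.
- by rewrite mulmxBl !mulmxBr block_idem ef fe ff subrr subr0.
- by rewrite mulmxBr fe ff subrr.
- by rewrite addrC subrK.
- move=> f0; rewrite f0 subr0 mulmx1 in zm.
  have w0 : w 0 = 0.
    have := wL (-1) 1%:M 1%:M (center1 k G) (center1 k G).
    by rewrite scaleN1r addNr mulN1r addNr.
  suffices Ew j : (iter j (mulmx (z *m e)) 1%:M \in ZG)%MS /\
      w (iter j (mulmx (z *m e)) 1%:M) = w z ^+ j.
    have [_] := Ew m; rewrite zm w0 => /esym/eqP.
    by rewrite expf_eq0 (negPf wz) andbF.
  elim: j => [|j [Zj Ej]] /=; first by rewrite center1 w1.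
  split; first exact: center_mul.
  by rewrite wM // wM // we mulr1 Ej exprS.
move/eqP; rewrite subr_eq0 => /eqP def_e; exists (e *m Y); split.
- exact: center_mul.
- by rewrite mulmxA -/f -def_e.
by rewrite mulmxA block_idem.
Qed.

Hypothesis realE : real_block e.

Lemma block_tr : e^T = e.
Proof. exact: real_block_tr block_center block_idem realE. Qed.

Lemma block_coefJ : {in G &, forall g x, gcoef e (g ^ x)%g = gcoef e g}.
Proof. by move=> g x Gg Gx; apply: centerJ block_center _ _. Qed.

Lemma block_mem : (e \in R_G)%MS. Proof. by case/center_mxP: block_center. Qed.

Lemma block_coefM :
  {in G, forall g, gcoef e g = \sum_(h in G) gcoef e h * gcoef e (h^-1 * g)%g}.
Proof. by move=> g Gg; rewrite -gcoefM ?block_idem ?block_mem. Qed.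

Lemma block_coefV g : g \in G -> gcoef e g^-1%g = gcoef e g.
Proof. by move=> Gg; rewrite -gcoef_tr ?block_mem ?block_tr. Qed.

Lemma block_support g : g \in G -> gcoef e g != 0 -> odd #[g].
Proof. exact: (idempotent_support char2 block_coefJ block_coefM). Qed.

Lemma real_classE C c : C \in classes G -> (C^-1)%g = C -> c \in C ->
  [/\ c \in G, C = rclass G c & (C \subset G)].
Proof.
case/imsetP=> x Gx -> realC xGc; have Gc : c \in G.
  by apply: subsetP xGc; rewrite class_subG.
have def_C : (x ^: G = c ^: G)%g by apply/esym/class_eqP.
split; rewrite ?class_subG //.
rewrite /rclass -def_C.
suffices -> : (c^-1 ^: G = x ^: G)%g by rewrite setUid.
by apply/class_eqP; rewrite -[(x ^: G)%g]realC inE invgK.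
Qed.

Lemma gset_mx_class C : C \in classes G -> (gset_mx k G C \in ZG)%MS.
Proof.
case/imsetP=> x Gx ->; apply/center_mxP; split.
  by rewrite gset_mxE ?class_subG // sum_group_ring.
move=> B /group_ringE->; rewrite mulmx_suml mulmx_sumr; apply: eq_bigr => y Gy.
rewrite -scalemxAl -scalemxAr; congr (_ *: _).
rewrite /gset_mx mulmx_sumr mulmx_suml.
rewrite (reindex_inj (conjg_inj y)) /=; apply: eq_big => [s|s xs].
  by rewrite memJ_norm // (subsetP (class_norm x G)).
have Gs : s \in G by case/imsetP: xs => z Gz E; rewrite -(groupJr s Gy) E groupJ.
by rewrite -!repr_mxM ?groupJ // -conjgC.
Qed.

(** The inverse of the class sum in Z(kG)e is unique, hence invariant under the
    contragredient map. *)
Lemma real_defect_data C : defect_class e C -> (C^-1)%g = C ->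
  exists Y, [/\ (Y \in ZG)%MS, Y^T = Y & gset_mx k G C *m Y = e].
Proof.
case=> clC _ [w wP wC] realC; have ZC := gset_mx_class clC.
have [c [_ Cc]] : exists c, true /\ c \in C.
  by case/imsetP: clC => c Gc ->; exists c; rewrite class_refl.
have [_ _ sCG] := real_classE clC realC Cc.
have trC : (gset_mx k G C)^T = gset_mx k G C.
  rewrite /gset_mx raddf_sum /= [RHS](reindex_inj invg_inj) /=.
  apply: eq_big => [x|x Cx]; first by rewrite -[C in RHS]realC inE invgK.
  by rewrite tr_regular // (subsetP sCG).
have [Y [ZY CY eY]] := block_local wP ZC wC.
exists Y; split=> //; have ZYt := center_tr ZY.
have YtC : Y^T *m gset_mx k G C = e by rewrite -{1}trC -trmx_mul CY block_tr.
have Yte : Y^T *m e = Y^T by rewrite -{1}block_tr -trmx_mul eY.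
by rewrite -Yte -CY mulmxA YtC.
Qed.

End Block.

(** * Traces of elements and projective forms *)

Section TraceVertex.

Variables (k : fieldType) (char2 : 2%N \in [pchar k]).
Variables (gT : finGroupType) (G : {group gT}).

Section RightCosets.

Variables (K : {group gT}) (F : gT -> k).
Hypotheses (sKG : K \subset G) (FK : rinv (V := k^o) K G F).

Lemma rcoset_reprE x : x \in G -> F (repr (K :* x))^-1%g = F x^-1%g.
Proof.
move=> Gx; have := mem_repr_rcoset K x; rewrite mem_rcoset -groupV => Kr.
by rewrite -[RHS](FK _ Kr) ?groupV // invMg invgK mulKg.
Qed.

Lemma weight_sum_rcosets :
  \sum_(x in G) coset_weight k K x *: (F x : k^o)
  = \sum_(A in rcosets K G) F (repr A)^-1%g.
Proof.
rewrite coset_weight_sum //.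
rewrite /lrep -(big_enum_val (A := mem (lcosets K G)) (fun A => F (repr A) : k^o)) /=.
rewrite [LHS](reindex_inj invg_inj) /=; apply: eq_big => A.
  apply/lcosetsP/rcosetsP=> [[x Gx EA]|[x Gx ->]].
    exists x^-1%g; rewrite ?groupV //; apply: invg_inj.
    by rewrite EA invg_rcoset invgK.
  by exists x^-1%g; rewrite ?groupV // invg_rcoset.
case/lcosetsP=> x Gx EA; have -> : A = (K :* x^-1)%g.
  by apply: invg_inj; rewrite EA invg_rcoset invgK.
rewrite rcoset_reprE ?groupV // invgK invg_rcoset invgK.
have := repr_lcoset_mem K x; rewrite mem_lcoset => Kr.
by rewrite -[RHS](FK _ Kr) // mulKVg.
Qed.

Lemma weight_sum_fixed (P : {group gT}) :
    2.-group P -> P \subset G -> {in P & G, forall p x, F (p * x)%g = F x} ->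
    \sum_(x in G) coset_weight k K x *: (F x : k^o) != 0 ->
  exists2 y, y \in G & (P :^ y)%g \subset K.
Proof.
move=> p2 sPG FP; rewrite weight_sum_rcosets.
rewrite (@fixed_points_sum _ char2 _ _ 'Rs%act P) //; last 2 first.
- exact: subset_trans sPG (actsRs_rcosets K G).
- move=> p _ Pp /rcosetsP[x Gx ->] /=; have Gp := subsetP sPG p Pp.
  by rewrite rcosetE -rcosetM !rcoset_reprE ?groupM // invMg FP ?groupV.
have [-> | [A]] := set_0Vmem 'Fix_(rcosets K G | 'Rs)(P)%g.
  by rewrite big_set0 eqxx.
case/setIP=> /rcosetsP[x Gx ->] /afixP fixP _.
exists x^-1%g; rewrite ?groupV //; apply/subsetP=> _ /imsetP[p Pp ->].
have := fixP p Pp; rewrite /= rcosetE -rcosetM => /rcoset_eqP.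
by rewrite mem_rcoset conjgE invgK mulgA.
Qed.

End RightCosets.

Section Module.

Variables (n : nat) (rM : mx_representation k G n).

(** Write the trace of v as a relative trace of x |-> tr(v x*B' B^-1). Since B'
    and B are symmetric, replacing v by v^-1 does not change these values: they
    are invariant under the extended centralizer of v, and only the cosets of K
    fixed by P contribute. *)
Lemma trace_vertex (P K : {group gT}) v :
    2.-group P -> v \in G -> P \subset ext_centralizer G v ->
    \tr (rM v) != 0 -> sym_projective rM K ->
  exists2 y, y \in G & (P :^ y)%g \subset K.
Proof.
move=> p2 Gv cP trv [B projB]; have [[symB uB BX] sKG _] := projB.
have sPG : P \subset G.
  by apply: subset_trans cP _; apply/subsetP=> x; rewrite inE => /andP[].
have [B' [symB' BK defB]] := form_projectiveE projB (@coset_weightP k _ K G).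
pose F w x := \tr (rM w *m twist rM x B' *m invmx B).
have iBX x : x \in G -> (rM x)^T *m invmx B = invmx B *m rM x^-1%g.
  move=> Gx; apply: (can_inj (mulKmx uB)); rewrite mulKVmx // !mulmxA.
  by rewrite -[x in LHS]invgK -(inv_formM BX) ?groupV // mulmxK.
have FV w x : w \in G -> F w^-1%g x = F w x.
  move=> Gw; rewrite /F -mxtrace_tr (trmx_mul _ (invmx B)) (trmx_mul (rM _)).
  rewrite tr_twist symB' trmx_inv symB.
  rewrite mulmxA mxtrace_mulC mulmxA iBX ?groupV // invgK mxtrace_mulC mulmxA.
  by rewrite mxtrace_mulC mulmxA.
have FJ p x : p \in G -> x \in G -> F v (p * x)%g = F (v ^ p)%g x.
  move=> Gp Gx; rewrite /F twistM //; move: (twist rM x B') => D.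
  rewrite /twist -!mulmxA iBX // !mulmxA.
  rewrite mxtrace_mulC !mulmxA -!repr_mxM ?groupM ?groupV //.
  by rewrite conjgE mulgA.
apply: (@weight_sum_fixed K (F v) sKG _ P p2 sPG).
- by move=> x h Gx Kh; rewrite /F (rinv_twist sKG BK).
- move=> p x Pp Gx; rewrite FJ ?(subsetP sPG p) //.
  have /subsetP/(_ p Pp) := cP.
  rewrite (mem_ext_centralizer (subsetP sPG p Pp) (set21 _ _)).
  by case/set2P=> ->; rewrite ?FV.
apply: contraNneq trv => E0.
rewrite -[rM v](mulmxK uB) {1}defB mulmx_sumr mulmx_suml raddf_sum /=.
rewrite -[X in _ == X]E0; apply/eqP/eq_bigr=> x Gx.
by rewrite -scalemxAr -scalemxAl linearZ.
Qed.

End Module.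

End TraceVertex.

(** * Modules in a real block *)

Section BlockModules.

Variables (k : fieldType) (char2 : 2%N \in [pchar k]).
Variables (gT : finGroupType) (G : {group gT}) (e : 'M[k]_#|G|).
Hypotheses (blockE : block_idempotent e) (realE : real_block e).
Variables (C : {set gT}) (c : gT) (E : {group gT}).
Hypotheses (clC : defect_class e C) (realC : (C^-1)%g = C) (Cc : c \in C).
Hypothesis sylE : 2.-Sylow(ext_centralizer G c) E.

Lemma real_defectP : [/\ c \in G, C = rclass G c & C \subset G].
Proof. by case: clC => clC' _ _; apply: real_classE. Qed.

Lemma defect_odd s : s \in C -> odd #[s].
Proof.
move=> Cs; have [_ _ sCG] := real_defectP.
by apply: (block_support char2 blockE (subsetP sCG s Cs)); case: clC => _ ->.
Qed.

Lemma ext_defect_sub : E \subset G.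
Proof. exact: subset_trans (pHall_sub sylE) (ext_centralizer_sub G c). Qed.

Lemma Sylow2_weight (H K X : {group gT}) (chi : gT -> k) :
  H \subset X -> 2.-Sylow(H) K -> weight K X chi -> weight H X chi.
Proof.
move=> sHX sylK; apply: weight_odd => //; first exact: pHall_sub sylK.
by rewrite odd_2'nat; case/and3P: sylK.
Qed.

Lemma real_class_sum (V : lmodType k) (F : gT -> V) :
  \sum_(s in C) F s = \sum_(x in G) coset_weight k E x *:
     \sum_(s in [set c; c^-1%g]) F (s ^ x^-1)%g.
Proof.
have [_ defC _] := real_defectP; rewrite {1}defC.
apply: rclass_sum; apply: (Sylow2_weight (ext_centralizer_sub G c) sylE).
exact: coset_weightP.
Qed.

Section Module.

Variables (n : nat) (rM : mx_representation k G n).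
Hypothesis eM : belongs_to e rM.

Lemma belongs_gring_op : gring_op rM e = 1%:M.
Proof.
rewrite gring_op_sum -[RHS]eM -(sum_invg (V := 'M[k]_n)); apply: eq_bigr => x Gx.
by rewrite (block_coefV blockE realE).
Qed.

Definition class_op : 'M[k]_n := \sum_(s in C) rM s.

Lemma class_op_unit : class_op \in unitmx.
Proof.
have [_ _ sCG] := real_defectP.
have [Y [/center_mxP[RY _] _ CY]] := real_defect_data blockE realE clC realC.
have : gring_op rM (gset_mx k G C) *m gring_op rM Y = 1%:M.
  by rewrite -gring_opM // CY belongs_gring_op.
have -> : gring_op rM (gset_mx k G C) = class_op.
  rewrite /gset_mx linear_sum; apply: eq_bigr => s Cs.
  by rewrite /= gring_opG // (subsetP sCG).
by case/mulmx1_unit.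
Qed.

Section ClassForm.

Variables (B : 'M[k]_n) (BX : X_form rM B).

Definition class_form : 'M[k]_n := \sum_(s in C) rM s *m B.

Lemma class_form_unit : class_form \in unitmx.
Proof.
by rewrite /class_form -mulmx_suml unitmx_mul class_op_unit; case: BX => _ ->.
Qed.

Lemma tr_rM_B s : s \in G -> (rM s *m B)^T = rM s^-1%g *m B.
Proof.
case: BX => symB _ invB Gs.
by rewrite trmx_mul symB (inv_formM invB) ?groupV // invgK.
Qed.

Lemma twist_rM_B s x : s \in G -> x \in G ->
  twist rM x (rM s *m B) = rM (s ^ x^-1)%g *m B.
Proof.
case: BX => _ _ invB Gs Gx; rewrite /twist mulmxA -mulmxA.
rewrite -[in (rM x)^T](invgK x) -(inv_formM invB) ?groupV //.
by rewrite !mulmxA -!repr_mxM ?groupM ?groupV // conjgE invgK mulgA.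
Qed.

(** The class sum of a defect class is invertible on M, so it turns any form B
    into another one, and being a relative trace itself it makes that form
    E-projective. *)
Lemma ext_defect_projective : sym_projective rM E.
Proof.
have [Gc defC sCG] := real_defectP.
have GA s : s \in [set c; c^-1%g] -> s \in G by case/set2P=> ->; rewrite ?groupV.
exists class_form.
apply: (form_projectiveI (chi := coset_weight k E)
          (B' := \sum_(s in [set c; c^-1%g]) rM s *m B)).
- exact: ext_defect_sub.
- exact: coset_weightP.
- rewrite raddf_sum /= [RHS](reindex_inj invg_inj) /=; apply: eq_big => s.
    by rewrite mem_set2V.
  by move=> /GA Gs; rewrite tr_rM_B.
- move=> h Eh; rewrite twist_sum.
  have Hh := subsetP (pHall_sub sylE) h Eh.
  have Gh := subsetP ext_defect_sub h Eh.
  rewrite [LHS](reindex_inj (conjg_inj h)) /=; apply: eq_big => s.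
    exact: (ext_centralizer_stable s Hh).
  by move=> /GA Gs; rewrite twist_rM_B // conjgK.
- rewrite /class_form real_class_sum; apply: eq_bigr => x Gx; congr (_ *: _).
  by rewrite twist_sum; apply: eq_bigr => s /GA Gs; rewrite twist_rM_B.
exact: class_form_unit.
Qed.

End ClassForm.

End Module.

(** For a single s the summand is not T-invariant in x, so that x |-> x * r s does
    not preserve its sum; it is the joint invariance in x and s that allows the
    shift. *)
Lemma weight_shift (V : lmodType k) (T : {group gT}) (S : {set gT}) (r : gT -> gT)
    (chi : gT -> k) (F : gT -> gT -> V) :
    T \subset G -> weight T G chi ->
    {in T & S, forall t s, (s ^ t)%g \in S} ->
    {in S, forall s, r s \in G} -> {in T & S, forall t s, r (s ^ t)%g = (r s ^ t)%g} ->
    {in G & S, forall x s, {in T, forall t, F (x * t)%g (s ^ t)%g = F x s}} ->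
  \sum_(x in G) \sum_(s in S) chi x *: F (x * r s)%g s
  = \sum_(x in G) \sum_(s in S) chi x *: F x s.
Proof.
move=> sTG chiP ST rG rT FT.
have STE t s : t \in T -> ((s ^ t)%g \in S) = (s \in S).
  move=> Tt; apply/idP/idP=> [Sst|]; last exact: ST.
  by rewrite -[s](conjgK t) ST ?groupV.
transitivity (\sum_(t in T) \sum_(x in G) \sum_(s in S)
   (chi (x * (r s)^-1)%g * chi (x * t)%g) *: F x s).
  transitivity (\sum_(s in S) \sum_(x in G) \sum_(t in T)
     (chi (x * (r s)^-1)%g * chi (x * t)%g) *: F x s); last first.
    rewrite exchange_big /= [RHS]exchange_big /=; apply: eq_bigr => x _.
    exact: exchange_big.
  rewrite exchange_big /=; apply: eq_bigr => s Ss.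
  rewrite -(sum_mulgr (V := V) _ (groupVr (rG s Ss))); apply: eq_bigr => x Gx.
  by rewrite mulgKV -scaler_suml -mulr_sumr chiP ?mulr1.
transitivity (\sum_(t in T) \sum_(x in G) \sum_(s in S)
   (chi (x * (r s)^-1 * t)%g * chi x) *: F x s); last first.
  rewrite exchange_big; apply: eq_bigr => x Gx /=; rewrite exchange_big /=.
  apply: eq_bigr => s Ss; rewrite -scaler_suml -mulr_suml chiP ?mul1r //.
  by rewrite groupM ?groupV ?rG.
rewrite -[RHS](sum_invg (V := V)); apply: eq_bigr => t Tt.
have Gt := subsetP sTG t Tt.
rewrite -(sum_mulgr (V := V) _ (groupVr Gt)); apply: eq_bigr => x Gx.
rewrite [LHS](reindex_inj (conjg_inj t^-1)%g) /=; apply: eq_big => s.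
  by rewrite STE ?groupV.
move=> Sst; have Ss : s \in S by rewrite -(STE t^-1%g) ?groupV.
rewrite FT ?groupV // mulgKV; congr (_ * _ *: _); congr chi.
by rewrite rT ?groupV // conjgE !invMg !invgK !mulgA mulgKV.
Qed.

End BlockModules.

Section VertexInDefect.

Variables (k : fieldType) (char2 : 2%N \in [pchar k]).
Variables (gT : finGroupType) (G : {group gT}) (e : 'M[k]_#|G|).
Hypotheses (blockE : block_idempotent e) (realE : real_block e).
Variables (C : {set gT}) (c : gT) (E : {group gT}).
Hypotheses (clC : defect_class e C) (realC : (C^-1)%g = C) (Cc : c \in C).
Hypothesis sylE : 2.-Sylow(ext_centralizer G c) E.
Variables (n : nat) (rM : mx_representation k G n).
Hypothesis eM : belongs_to e rM.

(** A weight for a Sylow 2-subgroup T of V is a weight for V, so the trace from V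
    is also a trace from T. *)
Lemma sym_projective_Sylow (V T : {group gT}) :
  2.-Sylow(V) T -> sym_projective rM V -> sym_projective rM T.
Proof.
move=> sylT [B projB]; have [[_ uB _] sVG _] := projB.
have sTV := pHall_sub sylT; have sTG := subset_trans sTV sVG.
have wT := @coset_weightP k _ T G.
have [B' [symB' BV defB]] :=
  form_projectiveE projB (Sylow2_weight char2 sVG sylT wT).
exists B; apply: (form_projectiveI sTG wT symB' _ defB uB).
exact: inv_formS BV.
Qed.

Section TwoGroup.

Variables (T : {group gT}) (B B' : 'M[k]_n).
Hypotheses (indM : mx_indecomposable rM) (sTG : T \subset G).
Hypotheses (BX : X_form rM B) (symB' : B'^T = B') (BT : inv_form rM T B').
Local Notation chi := (coset_weight k T).
Hypothesis defB : B = \sum_(x in G) chi x *: twist rM x B'.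

(** The form (u, v) |-> B'(u r, v r^-1) on row vectors, with r the square root of
    s: splitting s symmetrically makes transposition correspond to inverting s. *)
Definition half_form s : 'M[k]_n :=
  rM (sqrt_odd s) *m B' *m (rM (sqrt_odd s)^-1%g)^T.

Lemma tr_half_form s : s \in G -> (half_form s)^T = half_form s^-1%g.
Proof.
by move=> Gs; rewrite /half_form !trmx_mul trmxK symB' mulmxA sqrt_oddV invgK.
Qed.

Lemma twist_half_form s t : s \in G -> t \in T ->
  twist rM t (half_form s) = half_form (s ^ t^-1)%g.
Proof.
move=> Gs Tt; have Gt := subsetP sTG t Tt; have Gr := sqrt_mem Gs.
rewrite /half_form sqrt_oddJ -conjVg {1}/twist -!mulmxA -trmx_mul -repr_mxM ?groupV //.
rewrite !mulmxA -repr_mxM //.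
have -> : (t * sqrt_odd s = sqrt_odd s ^ t^-1 * t)%g.
  by rewrite conjgE invgK !mulgA mulgKV.
have -> : (t * (sqrt_odd s)^-1 = (sqrt_odd s)^-1 ^ t^-1 * t)%g.
  by rewrite conjgE invgK !mulgA mulgKV.
have Gr1 : (sqrt_odd s ^ t^-1)%g \in G by rewrite groupJ ?groupV.
have Gr2 : ((sqrt_odd s)^-1 ^ t^-1)%g \in G by rewrite groupJ ?groupV.
rewrite (repr_mxM rM Gr1 Gt) (repr_mxM rM Gr2 Gt) trmx_mul -!mulmxA; congr (_ *m _).
by rewrite !mulmxA -[X in X *m _ = _]/(twist rM t B') BT.
Qed.

(** The part of (u, v) |-> B(u C^+, v) that comes from the elements of S. *)
Definition half_trace (S : {set gT}) : 'M[k]_n :=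
  \sum_(x in G) chi x *: twist rM x (\sum_(s in S) half_form s).

(** B(u s, v) is a relative trace of terms B'(u s x, v x). In the sum over s and
    x, replacing x by x r moves half of s to the second argument. *)
Lemma class_form_half : class_form C rM B = half_trace C.
Proof.
have [_ _ sCG] := real_defectP clC realC Cc.
have [Gc defC _] := real_defectP clC realC Cc.
have GC := subsetP sCG.
transitivity (\sum_(x in G) \sum_(s in C) chi x *: twist rM x (half_form s)); last first.
  by apply: eq_bigr => x _; rewrite twist_sum scaler_sumr.
have rC : {in C, forall s, sqrt_odd s \in G} by move=> s /GC; apply: sqrt_mem.
rewrite -(@weight_shift k gT G 'M[k]_n T C (@sqrt_odd gT)) //; last 4 first.
- exact: coset_weightP.
- by move=> t s /(subsetP sTG) Gt Cs; rewrite defC rclassJ // -defC.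
- by move=> t s _ _; apply: sqrt_oddJ.
- move=> x s Gx Cs t Tt; have Gt := subsetP sTG t Tt.
  have Gst : (s ^ t)%g \in G by rewrite groupJ // GC.
  by rewrite twistM // (twist_half_form Gst Tt) conjgK.
rewrite /class_form {1}defB.
transitivity (\sum_(x in G) \sum_(s in C) chi x *: (rM s *m twist rM x B')).
  rewrite exchange_big /=; apply: eq_bigr => s Cs.
  by rewrite mulmx_sumr; apply: eq_bigr => x _; rewrite -scalemxAr.
apply: eq_bigr => x Gx.
rewrite [LHS](reindex_inj (conjg_inj x^-1)%g) /=; apply: eq_big => s.
  by rewrite {1}defC rclassJ ?groupV // -defC.
move=> Csx; have Cs : s \in C by move: Csx; rewrite defC rclassJ ?groupV.
have Gs := GC s Cs; have Gr := rC s Cs; congr (_ *: _).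
rewrite /twist /half_form !mulmxA -!repr_mxM ?groupM ?groupJ ?groupV //.
have -> : (s ^ x^-1 * x = x * sqrt_odd s * sqrt_odd s)%g.
  rewrite -(mulgA x) sqrt_oddK ?(defect_odd char2 blockE clC realC Cc) //.
  by rewrite conjgE invgK !mulgA mulgKV.
rewrite -!mulmxA -trmx_mul -repr_mxM ?groupM ?groupV //.
by rewrite mulgK.
Qed.

Lemma endo_half_trace (S : {set gT}) :
    S \subset G -> {in T & S, forall t s, (s ^ t)%g \in S} ->
  endo rM (half_trace S *m invmx B).
Proof.
move=> sSG ST x Xx; have [symB uB invB] := BX.
have HX : inv_form rM G (half_trace S).
  apply: (inv_form_sum sTG (@coset_weightP k _ T G)).
  move=> t Tt; rewrite twist_sum.
  rewrite [LHS](reindex_inj (conjg_inj t)) /=; apply: eq_big => s.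
    apply/idP/idP=> [Sst|]; last exact: ST.
    by rewrite -[s](conjgK t) ST ?groupV.
  move=> Sst; rewrite twist_half_form ?conjgK //.
  exact: (subsetP sSG).
rewrite mulmxA (inv_formM HX) // -!mulmxA; congr (_ *m _).
apply: (can_inj (mulKmx uB)); rewrite mulKVmx // !mulmxA.
by rewrite -(inv_formM invB) // mulmxK.
Qed.

Lemma rclass_stable (X : {group gT}) a :
  {in X & rclass X a, forall t s, (s ^ t)%g \in rclass X a}.
Proof. by move=> t s Xt; rewrite rclassJ. Qed.

(** Locality of the endomorphism ring selects a single orbit of T. *)
Lemma half_trace_orbit (S : {set gT}) :
    S \subset G -> {in S, forall s, rclass T s \subset S} ->
    half_trace S \in unitmx ->
  exists2 s, s \in S & half_trace (rclass T s) \in unitmx.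
Proof.
have [_ uB _] := BX.
have htB (A : {set gT}) :
    (half_trace A *m invmx B \in unitmx) = (half_trace A \in unitmx).
  by rewrite unitmx_mul unitmx_inv uB andbT.
have stab (A : {set gT}) : {in A, forall s, rclass T s \subset A} ->
    {in T & A, forall t s, (s ^ t)%g \in A}.
  move=> sA t s Tt As; apply: (subsetP (sA s As)).
  by rewrite rclassJ // rclass_refl.
elim: {S}_.+1 {-2}S (ltnSn #|S|) => // m IHm S leS sSG sS.
have [-> | [s Ss]] := set_0Vmem S.
  rewrite /half_trace big1 => [|x _].
    move/mxrank_unit; rewrite mxrank0 => n0; have [n_gt0 _] := indM.
    by rewrite -n0 in n_gt0.
  by rewrite big_set0 /twist mulmx0 mul0mx scaler0.
have sOS := sS s Ss; set O := rclass T s in sOS *.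
have defS : half_trace S = half_trace O + half_trace (S :\: O).
  rewrite /half_trace -big_split /=; apply: eq_bigr => x _.
  rewrite -scalerDr; congr (_ *: _).
  rewrite (bigID (fun s => s \in O)) /= /twist mulmxDr mulmxDl; congr (_ + _).
    congr (_ *m _ *m _); apply: eq_bigl => y.
    by rewrite andb_idl // => /(subsetP sOS).
  by congr (_ *m _ *m _); apply: eq_bigl => y; rewrite in_setD andbC.
have sDO : {in S :\: O, forall y, rclass T y \subset S :\: O}.
  move=> y /setDP[Sy nOy]; apply/subsetP=> z yz.
  rewrite in_setD (subsetP (sS y Sy)) // andbT.
  apply: contra nOy; case/rclassP: yz => x Tx zx; rewrite -(rclassJ s z Tx) -/O.
  by case/set2P: zx => ->; rewrite /O ?rclassV.
move=> uS; have := uS; rewrite -htB defS mulmxDl.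
case/(indec_add_unit indM).
- by apply: endo_half_trace; [apply: subset_trans sSG | apply: rclass_stable].
- by apply: endo_half_trace; [apply: subset_trans (subsetDl _ _) sSG | apply: stab].
- by rewrite htB; exists s.
rewrite htB => /(IHm _ _ (subset_trans (subsetDl _ _) sSG) sDO)[].
  rewrite ltnS in leS; apply: leq_trans leS.
  apply: proper_card; apply/properP; split; first exact: subsetDl.
  by exists s; rewrite // inE rclass_refl.
by move=> y /setDP[Sy _] uy; exists y.
Qed.

(** The orbit sum is the relative trace of the symmetric form
    half_form s + half_form s^-1 from the extended centralizer of s in T. *)
Lemma half_trace_projective s : s \in G -> half_trace (rclass T s) \in unitmx ->
  sym_projective rM (ext_centralizer_group T s).
Proof.
move=> Gs uH; pose K := ext_centralizer_group T s.
have sKT : K \subset T by apply: ext_centralizer_sub.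
have GA y : y \in [set s; s^-1%g] -> y \in G by case/set2P=> ->; rewrite ?groupV.
exists (half_trace (rclass T s)).
apply: (form_projectiveI (B' := \sum_(y in [set s; s^-1%g]) half_form y)
          (subset_trans sKT sTG)
          (weight_trans sKT sTG (@coset_weightP k _ T G) (@coset_weightP k _ K T))) => //.
- rewrite raddf_sum /= [RHS](reindex_inj invg_inj) /=; apply: eq_big => y.
    by rewrite mem_set2V.
  by move=> /GA Gy; rewrite tr_half_form.
- move=> h Kh; have Th := subsetP sKT h Kh; rewrite twist_sum.
  rewrite [LHS](reindex_inj (conjg_inj h)) /=; apply: eq_big => y.
    exact: (ext_centralizer_stable y Kh).
  move=> Ay; rewrite twist_half_form ?conjgK //; exact: GA.
rewrite (weight_trans_sum _ _ (fun x => twist rM x _) sTG).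
apply: eq_bigr => x Gx; congr (_ *: _).
rewrite (rclass_sum _ (@coset_weightP k _ K T)) twist_sum; apply: eq_bigr => t Tt.
rewrite twistZ twistM ?(subsetP sTG t) // [in RHS]twist_sum; congr (_ *: twist _ _ _).
by apply: eq_bigr => y /GA Gy; rewrite twist_half_form.
Qed.

End TwoGroup.

(** By minimality, T equals its extended centralizer at some s in C, and so lies
    in a conjugate of the extended centralizer of c. *)
Lemma sym_vertex_in_ext_defect (V : {group gT}) :
  mx_indecomposable rM -> sym_vertex rM V -> exists2 g, g \in G & (V :^ g)%g \subset E.
Proof.
move=> indM [_ _ projV minV].
have [T sylT] := Sylow_exists 2 V; have sTV := pHall_sub sylT.
have projT := sym_projective_Sylow sylT projV.
have eqTV : T :=: V := minV T sTV projT.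
have [B projB] := projT; have [BX sTG _] := projB.
have [B' [symB' BT defB]] := form_projectiveE projB (@coset_weightP k _ T G).
have [Gc defC sCG] := real_defectP clC realC Cc.
have uC := class_form_unit blockE realE clC realC Cc eM BX.
rewrite (class_form_half sTG BT defB) in uC.
have [|s Cs us] := half_trace_orbit indM sTG BX BT sCG _ uC.
  move=> s Cs; apply/subsetP=> y /rclassP[x Tx xy].
  rewrite defC -(rclassJ c y (subsetP sTG x Tx)) -defC.
  by case/set2P: xy => ->; rewrite // defC rclassV -defC.
have Gs := subsetP sCG s Cs.
have := half_trace_projective sTG symB' BT Gs us.
have sKT : ext_centralizer_group T s \subset T by apply: ext_centralizer_sub.
have sKV : ext_centralizer_group T s \subset V by rewrite -eqTV.
move/(minV _ sKV) => eqKV.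
have cT : {in T, forall t, (s ^ t)%g \in [set s; s^-1%g]}.
  move=> t Tt; rewrite -(mem_ext_centralizer Tt (set21 s _)).
  by rewrite [ext_centralizer T s]eqKV -eqTV.
move: Cs; rewrite defC => /rclassP[x Gx sx].
have sTx : (T :^ x)%g \subset ext_centralizer G c.
  apply/subsetP=> _ /imsetP[t Tt ->]; have Gt := subsetP sTG t Tt.
  rewrite (mem_ext_centralizer _ sx) ?groupJ // -conjJg.
  by case/set2P: (cT t Tt) => ->; rewrite // conjVg mem_set2V.
have p2T : 2.-group (T :^ x)%G by rewrite pgroupJ; apply: pHall_pgroup sylT.
have [z Hz sTz] := Sylow_subJ sylE sTx p2T.
have Gz := subsetP (ext_centralizer_sub G c) z Hz.
exists (x * z^-1)%g; first by rewrite groupM ?groupV.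
by rewrite -eqTV conjsgM sub_conjgV.
Qed.

End VertexInDefect.

(** * Witt reduction *)

(** Traces are additive in the exact sequence 0 -> D -> A -> D' -> 0 of modules
    for one operator, with J the inclusion and F the projection. *)
Lemma exact_trace (k : fieldType) (r n q : nat) (J : 'M[k]_(r, n)) (F : 'M[k]_(n, q))
    (A : 'M[k]_n) (D : 'M[k]_r) (D' : 'M[k]_q) :
    row_free J -> row_full F -> J *m F = 0 -> (r + q = n)%N ->
    J *m A = D *m J -> A *m F = F *m D' ->
  \tr A = \tr D + \tr D'.
Proof.
case/row_freeP=> J' JJ' /row_fullP[F' F'F] JF0 def_n JA AF; subst n.
pose M := col_mx J F'; pose N := row_mx (J' - F *m (F' *m J')) F.
have MN : M *m N = 1%:M.
  rewrite mul_col_row !mulmxBr JJ' JF0 !mulmxA JF0 !mul0mx F'F mul1mx subrr subr0.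
  by rewrite -scalar_mx_block.
have NM := mulmx1C MN.
rewrite -[A]mul1mx -NM -mulmxA mxtrace_mulC.
rewrite mul_col_mx JA mul_col_row mxtrace_block.
have JE : J *m (J' - F *m (F' *m J')) = 1%:M.
  by rewrite mulmxBr JJ' !mulmxA JF0 !mul0mx subr0.
rewrite -(mulmxA D) JE mulmx1.
by rewrite -mulmxA AF mulmxA F'F mul1mx.
Qed.

Lemma val_submod1J (k : fieldType) (gT : finGroupType) (G : {group gT}) n
    (rN : mx_representation k G n) (V : 'M[k]_n) (modV : mxmodule rN V) x :
  x \in G -> val_submod 1%:M *m rN x = submod_repr modV x *m val_submod 1%:M.
Proof. by move=> Gx; rewrite -(val_submodJ modV) // mul1mx -val_submodE. Qed.

Section RadicalQuotient.

Variables (k : fieldType) (gT : finGroupType) (G : {group gT}) (m : nat).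
Variables (rU : mx_representation k G m) (b : 'M[k]_m).
Hypotheses (symb : b^T = b) (bG : inv_form rU G b).

(** U modulo the radical of b is the column space of b; it carries the form
    induced by b, which is regular. *)
Lemma radical_quotient :
  exists (rQ : mx_representation k G (\rank b)) (bQ : 'M[k]_(\rank b)),
    X_form rQ bQ /\
    forall (r : nat) (S : 'M[k]_(r, m)) (D : gT -> 'M[k]_r),
      row_free S -> S *m b = 0 -> (r + \rank b = m)%N ->
      {in G, forall g, S *m rU g = D g *m S} ->
    {in G, forall g, \tr (rU g) = \tr (D g) + \tr (rQ g)}.
Proof.
pose F := col_base b; pose R := row_base b.
have bFR : b = F *m R by rewrite mulmx_base.
have fullF : row_full F := col_base_full b.
have freeR : row_free R := row_base_free b.
clearbody F R.
have [F' F'F] := row_fullP fullF; have [R' RR'] := row_freeP freeR.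
have FG g : g \in G -> F *m (F' *m rU g *m F) = rU g *m F.
  move=> Gg; have E : rU g *m F = F *m (R *m (rU g^-1%g)^T *m R').
    by rewrite -[LHS]mulmx1 -RR' !mulmxA -(mulmxA _ F) -bFR inv_formM // bFR.
  by rewrite -(mulmxA F') E (mulmxA F') F'F mul1mx.
have rQP : mx_repr G (fun g => F' *m rU g *m F).
  split=> [|x y Gx Gy]; first by rewrite repr_mx1 mulmx1.
  by rewrite repr_mxM // -[RHS]mulmxA FG // !mulmxA.
have FF'b : F *m F' *m b = b.
  transitivity (F *m R); last by rewrite -bFR.
  by rewrite [X in _ *m X = _]bFR mulmxA -(mulmxA F) F'F mulmx1.
pose bQ := F' *m b *m F'^T.
have FbQ : F *m bQ *m F^T = b.
  rewrite /bQ !mulmxA FF'b -mulmxA -trmx_mul.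
  by apply: trmx_inj; rewrite (trmx_mul b) trmxK symb FF'b.
have symbQ : bQ^T = bQ by rewrite /bQ !trmx_mul trmxK symb mulmxA.
have defbQ : bQ = F' *m b *m F'^T by [].
clearbody bQ.
exists (MxRepresentation rQP), bQ; split.
  split=> //.
  - rewrite -row_free_unit /row_free eqn_leq rank_leq_row /=.
    have : (\rank (F *m bQ *m F^T) <= \rank bQ)%N.
      exact: leq_trans (mxrankM_maxl _ _) (mxrankM_maxr _ _).
    by rewrite FbQ.
  move=> g Gg /=; rewrite !trmx_mul !mulmxA -(mulmxA _ F bQ) -(mulmxA _ (F *m bQ)) FbQ.
  by rewrite -(mulmxA F') -(mulmxA F') -[X in F' *m X]/(twist rU g b) bG.
move=> r S D freeS Sb defm SD g Gg.
have SF : S *m F = 0.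
  by rewrite -[LHS]mulmx1 -RR' mulmxA -(mulmxA S) -bFR Sb mul0mx.
apply: (exact_trace freeS fullF SF defm (SD g Gg)).
by rewrite /= FG.
Qed.

End RadicalQuotient.

Section Witt.

Variables (k : fieldType) (gT : finGroupType) (G : {group gT}).

Section Perp.

Variables (n : nat) (rN : mx_representation k G n) (B : 'M[k]_n).
Hypothesis BX : X_form rN B.

Definition perp (U : 'M[k]_n) : 'M[k]_n := kermx (B *m U^T).

Lemma perp_module U : mxmodule rN U -> mxmodule rN (perp U).
Proof.
have [_ _ invB] := BX; move=> /mxmoduleP modU; apply/mxmoduleP=> x Gx.
have /submxP[W UW] := modU x^-1%g (groupVr Gx).
apply/sub_kermxP; rewrite mulmxA -(mulmxA _ (rN x)) (inv_formM invB) //.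
rewrite -!mulmxA -trmx_mul UW trmx_mul !mulmxA -(mulmxA _ B).
by rewrite mulmx_ker mul0mx.
Qed.

Lemma rank_perp U : (\rank (perp U) + \rank U = n)%N.
Proof.
have [_ uB _] := BX; rewrite mxrank_ker.
have -> : \rank (B *m U^T) = \rank U.
  by rewrite (eqmxMfull _ _) ?row_full_unit // mxrank_tr.
by rewrite subnK ?rank_leq_row.
Qed.

Lemma perpK U : (perp (perp U) :=: U)%MS.
Proof.
have [symB _ _] := BX; apply/eqmx_sym/eqmxP.
have sUPP : (U <= perp (perp U))%MS.
  apply/sub_kermxP; apply: trmx_inj.
  rewrite (trmx_mul U) (trmx_mul B) trmxK symB trmx0 -mulmxA.
  exact: mulmx_ker.
rewrite -(mxrank_leqif_eq sUPP); apply/eqP/(@addnI (\rank (perp U))).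
by rewrite rank_perp addnC rank_perp.
Qed.

(** B identifies N / perp U with the dual of U. *)
Lemma trace_perp U (modU : mxmodule rN U) (modP : mxmodule rN (perp U)) :
  {in G, forall g, \tr (rN g)
    = \tr (submod_repr modP g) + \tr (submod_repr modU g^-1%g)}.
Proof.
have [symB uB invB] := BX; move=> g Gg.
rewrite -[in RHS](mxtrace_tr (submod_repr modU _)).
pose J := @val_submod k n U _ 1%:M; pose JP := @val_submod k n (perp U) _ 1%:M.
apply: (@exact_trace _ _ _ _ JP (B *m J^T)).
- by rewrite /row_free val_submod1.
- rewrite /row_full (eqmxMfull _ _) ?row_full_unit // mxrank_tr val_submod1 //.
- have /submxP[W ->] : (J <= U)%MS by rewrite val_submod1.
  rewrite trmx_mul !mulmxA -(mulmxA JP); have /submxP[W' ->] : (JP <= perp U)%MS.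
    by rewrite val_submod1.
  by rewrite -(mulmxA W') mulmx_ker mulmx0 mul0mx.
- exact: rank_perp.
- exact: val_submod1J.
by rewrite mulmxA (inv_formM invB) // -!mulmxA -!trmx_mul val_submod1J ?groupV.
Qed.

(** The radical of the restriction of B to U is U :&: perp U. Leaving R free up
    to equality of row spaces lets U and perp U share the same submodule R. *)
Lemma submod_radical U R (modU : mxmodule rN U) (modR : mxmodule rN R) :
    (R :=: U :&: perp U)%MS ->
  exists (q : nat) (rQ : mx_representation k G q) (bQ : 'M[k]_q),
    [/\ X_form rQ bQ, (q <= \rank U)%N
      & {in G, forall g, \tr (submod_repr modU g)
                          = \tr (submod_repr modR g) + \tr (rQ g)}].
Proof.
have [symB uB invB] := BX; move=> defR.
have [J [JU freeJ JG SJ]] : exists J : 'M[k]_(\rank U, n),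
    [/\ (J :=: U)%MS, row_free J,
        {in G, forall x, J *m rN x = submod_repr modU x *m J}
      & forall p (W : 'M[k]_(p, n)), (W <= U)%MS -> in_submod U W *m J = W].
  exists (val_submod 1%:M); split=> [||x Gx|p W sWU]; first exact: val_submod1.
  - by rewrite /row_free val_submod1.
  - exact: val_submod1J.
  by rewrite -val_submodE in_submodK.
have [JR [JRR JRG]] : exists JR : 'M[k]_(\rank R, n), (JR :=: R)%MS /\
    {in G, forall x, JR *m rN x = submod_repr modR x *m JR}.
  exists (val_submod 1%:M); split=> [|x Gx]; first exact: val_submod1.
  exact: val_submod1J.
have kerJ : (kermx (B *m J^T) :=: perp U)%MS.
  have [/submxP[W EW] /submxP[W' EW']] : (J <= U)%MS /\ (U <= J)%MS.
    by split; rewrite JU submx_refl.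
  have EUt : U^T = J^T *m W'^T by rewrite -trmx_mul -EW'.
  have EJt : J^T = U^T *m W^T by rewrite -trmx_mul -EW.
  apply/eqmxP/andP; split; apply/sub_kermxP.
    by rewrite EUt (mulmxA B) mulmxA mulmx_ker mul0mx.
  by rewrite EJt (mulmxA B) mulmxA mulmx_ker mul0mx.
pose b := J *m B *m J^T.
have symb : b^T = b by rewrite /b !trmx_mul trmxK symB mulmxA.
have bG : inv_form (submod_repr modU) G b.
  move=> g Gg; rewrite /twist /b !mulmxA -JG //.
  rewrite -!mulmxA -trmx_mul -JG // trmx_mul.
  by rewrite -{2}(invB g Gg) !mulmxA.
have [rQ [bQ [Qf trQ]]] := radical_quotient symb bG.
exists (\rank b), rQ, bQ; split=> //; first exact: rank_leq_row.
have sRU : (JR <= U)%MS by rewrite JRR defR capmxSl.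
have JRB0 : JR *m (B *m J^T) = 0.
  by apply/sub_kermxP; rewrite kerJ JRR defR capmxSr.
have [S [freeS SJR]] : exists S : 'M[k]_(\rank R, \rank U), row_free S /\ S *m J = JR.
  exists (in_submod U JR); split; last exact: SJ.
  by rewrite /row_free mxrank_in_submod // JRR.
apply: (trQ _ S) => //.
- by rewrite /b -mulmxA (mulmxA S) SJR.
- transitivity (\rank J); last by rewrite JU.
  rewrite -(mxrank_mul_ker J (B *m J^T)) addnC mulmxA.
  by congr (_ + _)%N; rewrite (cap_eqmx JU kerJ) defR.
move=> g Gg; apply: (row_free_inj freeJ).
by rewrite -(mulmxA S) -JG // (mulmxA S) SJR JRG // -(mulmxA _ S) SJR.
Qed.

End Perp.

End Witt.

Section WittReduction.

Variables (k : closedFieldType) (char2 : 2%N \in [pchar k]).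
Variables (gT : finGroupType) (G : {group gT}) (z : gT -> k).

Definition wtrace n (rM : mx_representation k G n) : k :=
  \sum_(g in G) z g * \tr (rM g).

Lemma wtraceD n n1 n2 (rM : mx_representation k G n)
    (D1 : mx_representation k G n1) (D2 : mx_representation k G n2) :
  {in G, forall g, \tr (rM g) = \tr (D1 g) + \tr (D2 g)} ->
  wtrace rM = wtrace D1 + wtrace D2.
Proof.
move=> trD; rewrite /wtrace -big_split; apply: eq_bigr => g Gg.
by rewrite trD // mulrDr.
Qed.

Hypothesis zV : forall n (rM : mx_representation k G n),
  \sum_(g in G) z g * \tr (rM g^-1%g) = wtrace rM.

(** For a submodule U with radical R, the Witt classes of N, of U / R and of
    perp U / R satisfy [N] = [U / R] + [perp U / R]; the traces on R and on its
    dual cancel. A module of minimal dimension is therefore irreducible. *)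
Lemma witt_irreducible n (rN : mx_representation k G n) B :
    X_form rN B -> wtrace rN != 0 ->
  exists m (rM : mx_representation k G m) (BM : 'M[k]_m),
    [/\ mx_irreducible rM, X_form rM BM & wtrace rM != 0].
Proof.
elim: {n}_.+1 {-2}n (ltnSn n) rN B => // d IHd n lend rN B BX trN.
have n_gt0 : (0 < n)%N.
  rewrite lt0n; apply: contraNneq trN => n0; subst n; rewrite /wtrace big1 // => g _.
  by rewrite /mxtrace big_ord0 mulr0.
have nz1 : 1%:M != 0 :> 'M[k]_n by rewrite -mxrank_eq0 mxrank1 -lt0n.
case: (mxnonsimpleP rN nz1) => [[U /and4P[modU _ nzU ltU]] | simN]; last first.
  exists n, rN, B; split=> //.
  by apply/mxsimpleP; split=> //; apply: mxmodule1.
rewrite mxrank1 in ltU.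
have modP := perp_module BX modU; have rkP := rank_perp BX U.
pose R := (U :&: perp B U)%MS.
have modR : mxmodule rN R by apply: capmx_module.
have [q [rQ [bQ [Qf leq_q trQ]]]] := submod_radical BX modU modR (eqmx_refl _).
have defR : (R :=: perp B U :&: perp B (perp B U))%MS.
  apply: eqmx_trans (cap_eqmx (eqmx_refl _) (eqmx_sym (perpK BX U))).
  by apply/eqmxP; rewrite /R capmxC submx_refl.
have [q' [rQ' [bQ' [Qf' leq_q' trQ']]]] := submod_radical BX modP modR defR.
have trE : wtrace rN = wtrace rQ + wtrace rQ'.
  have -> : wtrace rN = wtrace (submod_repr modP) + wtrace (submod_repr modU).
    rewrite -(zV (submod_repr modU)) /wtrace -big_split; apply: eq_bigr => g Gg /=.
    by rewrite (trace_perp BX modU modP) // mulrDr.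
  rewrite (wtraceD trQ) (wtraceD trQ') addrACA addrr_pchar2 // add0r addrC //.
have rkU : (0 < \rank U)%N by rewrite lt0n mxrank_eq0.
have [Q0 | nzQ] := eqVneq (wtrace rQ) 0; last first.
  by apply: (IHd _ _ rQ bQ) => //; apply: leq_ltn_trans leq_q (leq_trans ltU _).
apply: (IHd _ _ rQ' bQ') => //; last by rewrite trE Q0 add0r in trN.
have ltP : (\rank (perp B U) < \rank (perp B U) + \rank U)%N.
  by rewrite -addn1 leq_add2l.
apply: leq_ltn_trans leq_q' _; rewrite ltnS in lend; apply: leq_trans lend.
by rewrite rkP in ltP.
Qed.

End WittReduction.

Lemma irr_indecomposable (k : fieldType) (gT : finGroupType) (G : {group gT}) n
    (rM : mx_representation k G n) : mx_irreducible rM -> mx_indecomposable rM.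
Proof.
case/mx_irrP=> n_gt0 irrM; split=> // U V modU modV defUV dxUV.
have [-> | nzU] := eqVneq U 0; [by left | right].
apply/eqP; rewrite -submx0 -dxUV sub_capmx submx_refl andbT.
by apply: submx_full; apply: irrM.
Qed.

Lemma form_self_dual (k : fieldType) (gT : finGroupType) (G : {group gT}) n
    (rM : mx_representation k G n) B : X_form rM B -> self_dual rM.
Proof.
case=> _ uB invB; exists B => //; first by rewrite row_free_unit.
by move=> g Gg; rewrite (inv_formM invB).
Qed.

(** * The permutation module on the cosets of a Sylow subgroup *)

Section SylowPermutation.

Variables (k : fieldType) (char2 : 2%N \in [pchar k]).
Variables (gT : finGroupType) (G P : {group gT}) (sylP : 2.-Sylow(G) P).

Lemma triv_repr_proof : mx_repr P (fun _ : gT => 1%:M : 'M[k]_1).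
Proof. by split=> // x y _ _; rewrite mulmx1. Qed.

Definition triv_repr := MxRepresentation triv_repr_proof.

Lemma perm_form : X_form (ind_repr G triv_repr) 1%:M.
Proof.
split; [exact: trmx1 | exact: unitmx1 |] => g Gg.
rewrite mulmx1; suffices -> : (ind_repr G triv_repr g)^T = ind_repr G triv_repr g^-1%g.
  by rewrite -repr_mxM ?groupV // mulgV repr_mx1.
rewrite /= /ind_mx tr_mxblock; apply/eq_mxblockP => i j /=.
rewrite -groupV !invMg !invgK mulgA.
by case: ifP => _; rewrite ?trmx1 ?trmx0.
Qed.

(** For a 2-element g, the number of fixed cosets has the parity of #|G : P|. *)
Lemma trace_perm g : g \in G -> \tr (ind_repr G triv_repr g) = (2.-elt g)%:R.
Proof.
move=> Gg; have sPG := pHall_sub sylP.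
pose F x : k := ((x^-1 * g * x)%g \in P)%:R.
have FP : rinv (V := k^o) P G F.
  move=> x h _ Ph; rewrite /F invMg -!mulgA (groupMl _ (groupVr Ph)) !mulgA.
  by rewrite groupMr.
have -> : \tr (ind_repr G triv_repr g) = \sum_(x in G) coset_weight k P x *: (F x : k^o).
  rewrite coset_weight_sum //= /ind_mx mxtrace_mxblock; apply: eq_bigr => i _.
  by rewrite /F; case: ifP => _; rewrite ?mxtrace1 ?mxtrace0.
case p2g: (2.-elt g); last first.
  rewrite big1 // => x _; rewrite /F; case Pgx: (_ \in P); last by rewrite scaler0.
  have : 2.-elt (g ^ x)%g.
    by apply: mem_p_elt (pHall_pgroup sylP) _; rewrite conjgE mulgA.
  by rewrite p_eltJ p2g.
rewrite (weight_sum_rcosets sPG FP).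
have actQ : [acts <[g]>, on rcosets P G | 'Rs].
  by rewrite (subset_trans _ (actsRs_rcosets P G)) // cycle_subG.
have sum1 : \sum_(A in rcosets P G) (1 : k) = 1.
  rewrite sumr_const -/(indexg G P) -[#|_ : _|]odd_double_half odd_2'nat.
  have /and3P[_ _ ->] := sylP.
  by rewrite natrD -mul2n natrM (pcharf0 char2) mul0r addr0.
rewrite -[RHS]sum1.
rewrite (@fixed_points_sum _ char2 _ _ 'Rs%act <[g]>%G (rcosets P G) (fun _ => 1)) //.
rewrite [RHS](eq_bigl (fun A => (A \in rcosets P G) && (A \in afix 'Rs%act [set g]))).
  rewrite [RHS]big_mkcondr /=; apply: eq_bigr => _ /rcosetsP[x Gx ->].
  rewrite (rcoset_reprE FP Gx) /F invgK.
  have -> : ((P :* x)%g \in afix 'Rs%act [set g]) = ((x * g * x^-1)%g \in P).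
    apply/afix1P/idP=> [|Pxg]; rewrite /= rcosetE -rcosetM.
      by move/rcoset_eqP; rewrite mem_rcoset.
    by apply/rcoset_eqP; rewrite mem_rcoset.
  by case: ifP.
by move=> A; rewrite inE afix_cycle.
Qed.

End SylowPermutation.

(** * An irreducible module with the extended defect group as symmetric vertex *)

Section DefectModule.

Variables (k : closedFieldType) (char2 : 2%N \in [pchar k]).
Variables (gT : finGroupType) (G : {group gT}) (e : 'M[k]_#|G|).
Hypotheses (blockE : block_idempotent e) (realE : real_block e).
Variables (C : {set gT}) (c : gT) (E : {group gT}).
Hypotheses (clC : defect_class e C) (realC : (C^-1)%g = C) (Cc : c \in C).
Hypothesis sylE : 2.-Sylow(ext_centralizer G c) E.

(* A 2^#|G|-th root of c in <c>. The trace of e w^-1 on the permutation module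
   on the cosets of a Sylow subgroup is root_sum #|G| w, for u = 1: the sum of
   the coefficients of e at the elements g w with g a 2-element. *)
Let w : gT := iter #|G| (@sqrt_odd gT) c.
Let z (g : gT) : k := gcoef e (g * w)%g.

Lemma block_endo n (rM : mx_representation k G n) : endo rM (gring_op rM e).
Proof.
move=> x Gx; have /center_mxP[Re cRe] := block_center blockE.
rewrite -(gring_opG rM Gx) -!gring_opM ?envelop_mx_id //.
by rewrite -cRe ?envelop_mx_id.
Qed.

(** On an irreducible module with nonzero trace of e w^-1, the central idempotent
    e does not act as 0, so it acts as the identity. *)
Lemma exists_defect_module :
  exists n (rM : mx_representation k G n) (B : 'M[k]_n),
    [/\ mx_irreducible rM, X_form rM B, belongs_to e rM & \tr (rM w^-1%g) != 0].
Proof.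
have [Gc _ _] := real_defectP clC realC Cc.
have aJ := block_coefJ blockE; have aM := block_coefM blockE.
have aV g : g \in G -> gcoef e g^-1%g = gcoef e g by apply: block_coefV.
have Gw : w \in G by rewrite /w; elim: (#|G|) => //= m Gm; rewrite groupX.
have oc := defect_odd char2 blockE clC realC Cc Cc.
have [wK _] := iter_sqrt_oddK #|G| oc; rewrite -/w in wK.
(* c is real in G, hence so is its power w; this makes wtrace z agree on a
   module and on its dual. *)
have [y Gy wy] : exists2 y, y \in G & (w ^ y = w^-1)%g.
  have [clC' _ _] := clC; have /imsetP[x Gx defC] := clC'.
  have : (c^-1)%g \in C by rewrite -realC inE invgK.
  have defC' : C = (c ^: G)%g by rewrite defC; apply/esym/class_eqP; rewrite -defC.
  rewrite defC' => /imsetP[y Gy Ey]; exists y => //.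
  by rewrite /w -iter_sqrt_oddJ -Ey iter_sqrt_oddV.
have zV n (rM : mx_representation k G n) :
    \sum_(g in G) z g * \tr (rM g^-1%g) = wtrace z rM.
  rewrite -(sum_invg (V := k^o)) -(sum_conjg (V := k^o) _ Gy).
  apply: eq_bigr => g Gg; rewrite invgK /z; congr (_ * _).
    rewrite -aV ?groupM ?groupV ?groupJ // invMg invgK -wy -conjMg aJ ?groupM //.
    by rewrite -(aJ (w * g)%g w) ?groupM // conjgE -mulgA mulKg.
  rewrite conjgE !repr_mxM ?groupM ?groupV // mxtrace_mulC -mulmxA.
  by rewrite -repr_mxM ?groupV // mulgV repr_mx1 mulmx1.
have [P sylP] := Sylow_exists 2 G.
have nz : wtrace z (ind_repr G (triv_repr k P)) != 0.
  have nzc : gcoef e c != 0 by case: clC => _ ->.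
  have uG : {in G, forall x : gT, (1 ^ x)%g = 1%g :> gT} by move=> x _; apply: conj1g.
  have := root_sum_iter char2 aJ aM uG #|G| Gw.
  rewrite wK (root_sum0 (gcoef e) c (group1 G)) mul1g => def_ac.
  apply: contraNneq nzc => z0; rewrite def_ac /root_sum.
  rewrite [X in X ^+ _](_ : _ = 0) ?expr0n ?expn_eq0 // -[RHS]z0 /wtrace.
  rewrite big_mkcondr /=; apply: eq_bigr => g Gg; rewrite (trace_perm char2 sylP) //.
  have -> : (g ^+ (2 ^ #|G|) == 1)%g = 2.-elt g.
    rewrite -order_dvdn; apply/idP/idP=> [dv|].
      by apply: pnat_dvd dv _; rewrite pnatX pnat_id.
    case/p_natP=> j ord; rewrite ord dvdn_exp2l //.
    apply: leq_trans (dvdn_leq (cardG_gt0 G) (order_dvdG Gg)).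
    by rewrite ord ltnW // ltn_expl.
  by case: ifP => _; rewrite ?mulr1 ?mulr0.
have [n [rM [B [irrM BX trM]]]] := witt_irreducible char2 zV (perm_form k G P) nz.
have trE : wtrace z rM = \tr (gring_op rM e *m rM w^-1%g).
  rewrite gring_op_sum mulmx_suml raddf_sum /= /wtrace.
  rewrite -(sum_mulgr (V := k^o) _ (groupVr Gw)); apply: eq_bigr => g Gg.
  by rewrite /z mulgKV -scalemxAl linearZ /= repr_mxM ?groupV.
have ff : gring_op rM e *m gring_op rM e = gring_op rM e.
  by rewrite -gring_opM ?(block_mem blockE) // (block_idem blockE).
exists n, rM, B; rewrite trE in trM.
case: (indec_idempotent (irr_indecomposable irrM) (block_endo rM) ff) => f01.
  by rewrite f01 mul0mx linear0 eqxx in trM.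
rewrite f01 mul1mx in trM; split=> //.
rewrite /belongs_to -[RHS]f01 gring_op_sum -[RHS](sum_invg (V := 'M[k]_n)).
by apply: eq_bigr => x Gx; rewrite aV.
Qed.

(** E centralizes or inverts w, because w is a power of c. *)
Lemma ext_defect_sym_vertex : exists n (rM : mx_representation k G n),
  [/\ mx_irreducible rM, self_dual rM, belongs_to e rM & sym_vertex rM E].
Proof.
have [n [rM [B [irrM BX eM trM]]]] := exists_defect_module.
have [Gc _ _] := real_defectP clC realC Cc.
have Gw : w \in G by rewrite /w; elim: (#|G|) => //= m Gm; rewrite groupX.
exists n, rM; split=> //; first exact: form_self_dual BX.
split.
- exact: irr_indecomposable.
- by exists B.
- exact: (ext_defect_projective char2 blockE realE clC realC Cc sylE eM BX).
move=> K sKE projK.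
have cE : E \subset ext_centralizer G w^-1%g.
  apply/subsetP=> x Ex.
  have Hx := subsetP (pHall_sub sylE) x Ex.
  have Gx := subsetP (ext_defect_sub sylE) x Ex.
  rewrite (mem_ext_centralizer Gx (set21 _ _)).
  rewrite (mem_ext_centralizer Gx (set21 _ _)) in Hx.
  rewrite /w -iter_sqrt_oddV -iter_sqrt_oddJ -iter_sqrt_oddV invgK conjVg.
  by case/set2P: Hx => ->; rewrite ?invgK !inE eqxx ?orbT.
have [|y Gy sEK] := trace_vertex char2 (pHall_pgroup sylE) _ cE trM projK.
  by rewrite groupV.
apply/eqP; rewrite eqEcard sKE -(cardJg E y); exact: subset_leq_card.
Qed.

End DefectModule.

(** * The block as a bimodule *)

Section DiagonalWeights.

Variables (k : fieldType) (gT : finGroupType).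
Implicit Types G K : {group gT}.

Lemma sum_diag (V : nmodType) (K : {group gT}) (F : gT * gT -> V) :
  \sum_(p in diag_set K) F p = \sum_(x in K) F (x, x).
Proof. by rewrite big_imset //= => x y _ _ [->]. Qed.

Lemma diag_weight1 K G chi : weight (k := k) K G chi ->
  weight (diag_group K) (setX_group G G) (fun p => chi p.1).
Proof.
move=> chiP [x y]; rewrite inE /= => /andP[Gx _].
by rewrite (sum_diag (V := k)) chiP.
Qed.

Lemma diag_weight2 K G chi : weight (k := k) K G chi ->
  weight (diag_group K) (setX_group G G) (fun p => chi p.2).
Proof.
move=> chiP [x y]; rewrite inE /= => /andP[_ Gy].
by rewrite (sum_diag (V := k)) chiP.
Qed.

Lemma diag_sub K G : K \subset G -> diag_group K \subset setX_group G G.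
Proof.
move=> /subsetP sKG; apply/subsetP=> _ /imsetP[x Kx ->].
by rewrite inE /= !sKG.
Qed.

Lemma sum_setX (V : nmodType) G (F : gT * gT -> V) :
  \sum_(p in setX G G) F p = \sum_(u in G) \sum_(v in G) F (u, v).
Proof.
rewrite pair_big_dep /=; apply: eq_big => [[u v]|[u v] _] //.
by rewrite inE.
Qed.

End DiagonalWeights.

Section BimoduleForms.

Variables (k : fieldType) (gT : finGroupType) (G : {group gT}).
Local Notation gi := (gring_index G).
Local Notation rho := (bireg_repr k G).
Local Notation aG := (regular_repr k G).

(** The Gram matrix of the form that multiplies the coefficients at x and y. *)
Definition dmx (x y : gT) : 'M[k]_#|G| := delta_mx (gi x) (gi y).

Lemma twist_entry (A : 'M[k]_#|G|) u v x y :
    u \in G -> v \in G -> x \in G -> y \in G ->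
  twist rho (u, v) A (gi x) (gi y) = A (gi (u^-1 * x * v)%g) (gi (u^-1 * y * v)%g).
Proof.
move=> Gu Gv Gx Gy; have Gp : (u, v) \in setX G G by rewrite inE /= Gu.
have rowE' z m (M : 'M[k]_(#|G|, m)) j : z \in G ->
    (rho (u, v) *m M) (gi z) j = M (gi (u^-1 * z * v)%g) j.
  move=> Gz; transitivity (row (gi z) (rho (u, v) *m M) 0 j); first by rewrite [RHS]mxE.
  by rewrite row_mul /= row_bireg // -rowE mxE.
rewrite /twist -mulmxA rowE' //.
transitivity ((rho (u, v) *m A^T) (gi y) (gi (u^-1 * x * v)%g)).
  by rewrite -[A in LHS]trmxK -trmx_mul [LHS]mxE.
by rewrite rowE' // mxE.
Qed.

Lemma matG_eq (A B : 'M[k]_#|G|) :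
  {in G &, forall x y, A (gi x) (gi y) = B (gi x) (gi y)} -> A = B.
Proof.
move=> eqAB; apply/matrixP=> i j.
by rewrite -(gring_valK i) -(gring_valK j) eqAB ?enum_valP.
Qed.

Lemma dmxE a b x y : a \in G -> b \in G -> x \in G -> y \in G ->
  dmx a b (gi x) (gi y) = ((x == a) && (y == b))%:R.
Proof. by move=> Ga Gb Gx Gy; rewrite mxE !gi_eq. Qed.

Lemma twist_dmx u v a b : u \in G -> v \in G -> a \in G -> b \in G ->
  twist rho (u, v) (dmx a b) = dmx (u * a * v^-1)%g (u * b * v^-1)%g.
Proof.
move=> Gu Gv Ga Gb; apply: matG_eq => x y Gx Gy.
rewrite twist_entry // !dmxE ?groupM ?groupV //.
have E z d : (u^-1 * z * v == d)%g = (z == u * d * v^-1)%g.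
  apply/eqP/eqP=> [<-|->]; rewrite !mulgA; first by rewrite mulgV mul1g mulgK.
  by rewrite mulVg mul1g mulgKV.
by rewrite !E.
Qed.

Lemma tr_dmx a b : (dmx a b)^T = dmx b a.
Proof. by rewrite /dmx trmx_delta. Qed.

Lemma regular_dmx s : s \in G -> aG s = \sum_(u in G) dmx u (u * s)%g.
Proof.
move=> Gs; apply: matG_eq => x y Gx Gy; rewrite summxE (bigD1 x) //= big1.
  rewrite addr0 dmxE ?groupM // eqxx /= -bireg_regular.
  by rewrite bireg_entry ?inE ?group1 //= invg1 mul1g eq_sym.
move=> u /andP[Gu ne_ux]; rewrite dmxE ?groupM //.
by rewrite eq_sym (negPf ne_ux).
Qed.

Lemma inv_form_center (A : 'M[k]_#|G|) : inv_form rho (setX G G) A ->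
  (A \in 'Z(group_ring k G))%MS.
Proof.
move=> invA; apply/center_bireg=> p Gp; have := inv_formM invA Gp.
by rewrite /= tr_bireg ?groupV // invgK => ->.
Qed.

End BimoduleForms.

Section BlockBimodule.

Variables (k : fieldType) (gT : finGroupType) (G : {group gT}) (e : 'M[k]_#|G|).
Hypotheses (blockE : block_idempotent e) (realE : real_block e).
Local Notation rho := (bireg_repr k G).
Local Notation rB := (block_repr blockE).

(** J is the inclusion of kG e in kG, and P the projection of kG onto kG e. *)
Lemma block_coords : exists (J : 'M[k]_(\rank e, #|G|)) (P : 'M[k]_(#|G|, \rank e)),
  [/\ P *m J = e, J *m P = 1%:M, block_form e = J *m J^T,
      {in setX G G, forall p, J *m rho p = rB p *m J}
    & {in setX G G, forall p, rho p *m P = P *m rB p}].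
Proof.
have ee := block_idem blockE.
pose J := @val_submod k _ e _ 1%:M.
have Je : J *m e = J.
  have /submxP[W ->] : (J <= e)%MS by rewrite val_submod1.
  by rewrite -mulmxA ee.
exists J, (in_submod e e).
have PJ : in_submod e e *m J = e by rewrite -val_submodE in_submodK.
have JG : {in setX G G, forall p, J *m rho p = rB p *m J}.
  by move=> p Gp; apply: val_submod1J.
split=> //.
- by rewrite in_submodE mulmxA Je -in_submodE val_submodK.
- apply/matrixP=> i j; rewrite mxE /bform mulmx1 !mxE.
  apply: eq_bigr => l _; congr (_ * _).
    by rewrite val_submodE -rowE mxE.
  by rewrite mxE val_submodE -rowE !mxE.
move=> p Gp; apply: (row_free_inj (A := J)); first by rewrite /row_free val_submod1.
rewrite -(mulmxA (rho p)) PJ -(mulmxA (in_submod e e)) -JG //.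
rewrite (mulmxA (in_submod e e)) PJ.
by have /center_bireg/(_ p Gp) := block_center blockE.
Qed.

(** The matrix e is symmetric, and P^T P inverts J J^T. *)
Lemma block_form_X_form : X_form rB (block_form e).
Proof.
have [J [P [PJ JP -> JG _]]] := block_coords.
have et := block_tr blockE realE.
split; first by rewrite trmx_mul trmxK.
  suffices /mulmx1_unit[] : J *m J^T *m (P^T *m P) = 1%:M by [].
  have eP : P *m J *m P = P by rewrite -mulmxA JP mulmx1.
  rewrite PJ in eP.
  by rewrite mulmxA -(mulmxA J) -trmx_mul PJ et -(mulmxA J) eP.
move=> p Gp; rewrite mulmxA -JG // -!mulmxA -trmx_mul -JG // trmx_mul.
by rewrite (mulmxA (rho p)) /= tr_bireg // -(repr_mxM rho) ?groupV // mulgV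
  (repr_mx1 rho) mul1mx.
Qed.

(** An idempotent bimodule endomorphism of kG e is multiplication by a central
    idempotent, so e being primitive makes kG e indecomposable. *)
Lemma block_indecomposable : mx_indecomposable rB.
Proof.
have [J [P [PJ JP _ JG PG]]] := block_coords.
have ee := block_idem blockE; have [_ _ nz_e prim] := blockE.
split=> [|U V modU modV defUV dxUV]; first by rewrite lt0n mxrank_eq0.
have Je : J *m (P *m J) = J by rewrite mulmxA JP mul1mx.
rewrite PJ in Je.
pose f := proj_mx U V.
have fG : {in setX G G, forall p, f *m rB p = rB p *m f}.
  move=> p Gp; have /hom_mxP homf := proj_mx_hom dxUV modU modV.
  have /submxP[W W1] : ((1%:M : 'M[k]_(\rank e)) <= U + V)%MS by rewrite defUV.
  have := homf p Gp; rewrite -/f; move: (U + V)%MS W1 (rB p) f => S W1 D g.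
  by move/(congr1 (mulmx W)); rewrite !mulmxA -!W1 !mul1mx => /esym.
have ff : f *m f = f by apply: proj_mx_proj.
have Uf : U *m f = U by apply: proj_mx_id.
have Vf : V *m f = 0 by apply: proj_mx_0.
clearbody f; pose h := P *m f *m J.
have Zh : (h \in 'Z(group_ring k G))%MS.
  apply/center_bireg=> p Gp; rewrite /h -[bireg_mx k G p]/(rho p).
  move: (rho p) (rB p) (JG p Gp) (PG p Gp) (fG p Gp) => A D JA AP fD.
  by rewrite -mulmxA JA -(mulmxA P) (mulmxA f) fD !mulmxA AP.
have Ze := block_center blockE.
have hh : h *m h = h.
  by rewrite /h -!mulmxA (mulmxA J) JP mul1mx !(mulmxA f) ff.
have he : h *m e = h by rewrite /h -!mulmxA Je.
have eh : e *m h = h by rewrite (center_comm Ze Zh).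
have fE : J *m h *m P = f by rewrite /h !mulmxA JP mul1mx -mulmxA JP mulmx1.
case: (prim h (e - h)) => //.
- exact: centerB.
- by rewrite mulmxBl !mulmxBr ee eh he hh subrr subr0.
- by rewrite mulmxBr he hh subrr.
- by rewrite addrC subrK.
- move=> h0; left; rewrite h0 mulmx0 mul0mx in fE.
  by rewrite -Uf -fE mulmx0.
move=> /eqP; rewrite subr_eq0 => /eqP eh'; right.
rewrite -eh' Je JP in fE.
by rewrite -[V]mulmx1 fE.
Qed.

End BlockBimodule.

Section BlockVertex.

Variables (k : fieldType) (char2 : 2%N \in [pchar k]).
Variables (gT : finGroupType) (G : {group gT}) (e : 'M[k]_#|G|).
Hypotheses (blockE : block_idempotent e) (realE : real_block e).
Local Notation rho := (bireg_repr k G).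
Local Notation rB := (block_repr blockE).
Local Notation gi := (gring_index G).
Local Notation aG := (regular_repr k G).

Section Projective.

Variables (C : {set gT}) (c : gT) (E : {group gT}).
Hypotheses (clC : defect_class e C) (realC : (C^-1)%g = C) (Cc : c \in C).
Hypothesis sylE : 2.-Sylow(ext_centralizer G c) E.

Variables (Y : 'M[k]_#|G|).
Hypotheses (ZY : (Y \in 'Z(group_ring k G))%MS) (symY : Y^T = Y)
  (CY : gset_mx k G C *m Y = e).

(* The coefficients of (c + c^-1) Y (of c Y if c = c^-1), whose relative trace
   from E to G is C^+ Y = e. *)
Let d (g : gT) : k := \sum_(s in [set c; c^-1%g]) gcoef Y (s^-1 * g)%g.

Let Gc : c \in G. Proof. by have [] := real_defectP clC realC Cc. Qed.
Let sCG : C \subset G. Proof. by have [] := real_defectP clC realC Cc. Qed.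
Let GA s : s \in [set c; c^-1%g] -> s \in G.
Proof. by case/set2P=> ->; rewrite ?groupV Gc. Qed.
Let RY : (Y \in group_ring k G)%MS. Proof. by case/center_mxP: ZY. Qed.

Lemma defect_coef g : g \in G ->
  gcoef e g = \sum_(x in G) coset_weight k E x * d (g ^ x)%g.
Proof.
move=> Gg; rewrite -CY gcoefM //.
transitivity (\sum_(s in C) (gcoef Y (s^-1 * g)%g : k^o)).
  rewrite [LHS]big_mkcond [RHS]big_mkcond /=; apply: eq_bigr => s _.
  case Gs: (s \in G); last by case: ifP => // Cs; rewrite (subsetP sCG) in Gs.
  by rewrite gset_mxE // gcoef_sum //; case: ifP => _; rewrite ?mul1r ?mul0r.
rewrite (real_class_sum char2 clC realC Cc sylE); apply: eq_bigr => x Gx.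
rewrite /d; congr (_ * _); apply: eq_bigr => s /GA Gs.
rewrite -(centerJ ZY _ Gx) ?groupM ?groupV ?groupJ ?groupV //.
by rewrite conjMg conjVg conjgKV.
Qed.

Lemma defect_coefV g : g \in G -> d g^-1%g = d g.
Proof.
move=> Gg; rewrite /d [RHS](reindex_inj invg_inj) /=; apply: eq_big => s.
  by rewrite mem_set2V.
move=> /GA Gs; rewrite invgK -[in RHS]symY gcoef_tr ?groupM // invMg.
by rewrite -(centerJ ZY _ Gg) ?groupM ?groupV // conjgE mulgKV.
Qed.

Lemma defect_coefJ g t : g \in G -> t \in E -> d (g ^ t)%g = d g.
Proof.
move=> Gg Et; have Gt := subsetP (ext_defect_sub sylE) t Et.
have Ht := subsetP (pHall_sub sylE) t Et.
rewrite /d (reindex_inj (conjg_inj t)) /=; apply: eq_big => s.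
  exact: (ext_centralizer_stable s Ht).
move=> Ast; have Gs : s \in G by rewrite -(groupJr s Gt) GA.
by rewrite -conjVg -conjMg centerJ ?groupM ?groupV.
Qed.

(** B_1(x e, y) is the sum of the terms e_s x_a y_b with b^-1 a = s. Since e is
    supported on elements of odd order, the pairs (a, b) with quotient s lie in
    the G x G-orbit of the symmetric pair (r, r^-1), r the square root of s, and
    the relative trace e = Tr_E(d) lifts to a trace of symmetric forms. *)
Definition source_form : 'M[k]_#|G| :=
  \sum_(s in G | odd #[s]) d s *: dmx k G (sqrt_odd s) (sqrt_odd s)^-1%g.

Lemma tr_source_form : source_form^T = source_form.
Proof.
rewrite /source_form raddf_sum /= [RHS](reindex_inj invg_inj) /=.
apply: eq_big => s; first by rewrite groupV orderV.
move=> /andP[Gs _]; rewrite linearZ /= tr_dmx defect_coefV //.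
by rewrite sqrt_oddV invgK.
Qed.

Lemma twist_source_dmx u v s : u \in G -> v \in G -> s \in G ->
  twist rho (u, v) (dmx k G (sqrt_odd s) (sqrt_odd s)^-1%g)
  = dmx k G (u * sqrt_odd s * v^-1)%g (u * (sqrt_odd s)^-1 * v^-1)%g.
Proof. by move=> Gu Gv Gs; rewrite twist_dmx ?groupV ?sqrt_mem. Qed.

Lemma inv_source_form : inv_form rho (diag_set E) source_form.
Proof.
move=> _ /imsetP[t Et ->]; have Gt := subsetP (ext_defect_sub sylE) t Et.
rewrite twist_sum /source_form [LHS](reindex_inj (conjg_inj t)) /=.
apply: eq_big => s; first by rewrite groupJr // orderJ.
move=> /andP[Gst _]; have Gs : s \in G by rewrite -(groupJr s Gt).
rewrite twistZ defect_coefJ // twist_source_dmx // sqrt_oddJ -conjVg.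
by rewrite !conjgE !mulgA !mulgV !mul1g !mulgK.
Qed.

Lemma source_form_trace :
  e = \sum_(p in setX G G) coset_weight k E p.2 *: twist rho p source_form.
Proof.
have et := block_tr blockE realE; have Re := block_mem blockE.
transitivity (\sum_(s in G) gcoef e s *: (aG s)^T).
  rewrite -[LHS]et {1}(group_ringE Re) raddf_sum; apply: eq_bigr => s _.
  by rewrite /= linearZ.
rewrite sum_setX exchange_big /=.
transitivity (\sum_(u in G) \sum_(v in G) \sum_(s in G | odd #[s])
    (coset_weight k E v * d (s ^ v)%g) *:
      dmx k G (u * sqrt_odd s)%g (u * (sqrt_odd s)^-1)%g); last first.
  rewrite [LHS]exchange_big /=; apply: eq_bigr => v Gv.
  rewrite -[RHS](sum_mulgr (V := 'M[k]_#|G|) _ Gv); apply: eq_bigr => u Gu.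
  rewrite twist_sum scaler_sumr [RHS](reindex_inj (conjg_inj v)) /=.
  apply: eq_big => s; first by rewrite groupJr // orderJ.
  move=> /andP[Gs _]; have Gsv : (s ^ v)%g \in G by rewrite groupJ.
  rewrite twistZ scalerA (twist_source_dmx (groupM Gu Gv) Gv Gsv) /=.
  by rewrite sqrt_oddJ -conjVg !conjgE !mulgA !mulgK.
transitivity (\sum_(u in G) \sum_(s in G | odd #[s])
    gcoef e s *: dmx k G (u * sqrt_odd s)%g (u * (sqrt_odd s)^-1)%g); last first.
  apply: eq_bigr => u _; rewrite [RHS]exchange_big /=; apply: eq_bigr => s /andP[Gs _].
  by rewrite -scaler_suml defect_coef.
rewrite exchange_big /= big_mkcondr /=; apply: eq_bigr => s Gs.
case os: (odd _); last first.
  have [->|nz] := eqVneq (gcoef e s) 0; first by rewrite scale0r.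
  by rewrite (block_support char2 blockE Gs nz) in os.
rewrite -scaler_sumr; congr (_ *: _); rewrite regular_dmx // raddf_sum /=.
rewrite -[RHS](sum_mulgr (V := 'M[k]_#|G|) _ (sqrt_mem Gs)); apply: eq_bigr => u _.
by rewrite tr_dmx mulgK -mulgA sqrt_oddK.
Qed.

Lemma block_form_projective : form_projective rB (block_form e) (diag_group E).
Proof.
have [J [P [PJ JP bfE JG _]]] := block_coords blockE.
have sEG := ext_defect_sub sylE.
have uB : block_form e \in unitmx by case: (block_form_X_form blockE realE).
have JX p B : p \in setX G G -> twist rB p (J *m B *m J^T) = J *m twist rho p B *m J^T.
  move=> Gp; move: (JG p Gp); rewrite /twist; move: (rho p) (rB p) => A D JA.
  by rewrite !mulmxA -JA -!mulmxA -trmx_mul -JA trmx_mul.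
apply: (form_projectiveI (B' := J *m source_form *m J^T) (diag_sub sEG)
          (diag_weight2 (@coset_weightP k _ E G)) _ _ _ uB).
- by rewrite !trmx_mul trmxK tr_source_form mulmxA.
- move=> p Ep; rewrite JX ?(subsetP (diag_sub sEG)) //.
  by rewrite inv_source_form.
have Je : J *m (P *m J) = J by rewrite mulmxA JP mul1mx.
rewrite PJ in Je; have -> : block_form e = J *m e *m J^T by rewrite Je.
rewrite (congr1 (fun A : 'M_#|G| => J *m A *m J^T) source_form_trace).
rewrite mulmx_sumr mulmx_suml.
by apply: eq_bigr => p Gp; rewrite JX // -scalemxAr -scalemxAl.
Qed.

End Projective.

Section Restrict.

Variables (n : nat) (rM : mx_representation k G n) (B : 'M[k]_n).
Hypotheses (eM : belongs_to e rM) (BX : X_form rM B).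

(** M is the tensor product over kG of the block and of M. A form b on the block
    and B on M induce the form (u, v) |-> \sum_g b(1, g) B(u, v g) on M, which is
    K-projective when b is Delta K-projective. *)
Lemma block_projective_restrict (K : {group gT}) : K \subset G ->
  sym_projective rB (diag_group K) -> sym_projective rM K.
Proof.
move=> sKG [b projb]; have [[symb ub bX] _ _] := projb.
have [symB uB invB] := BX.
have [J [P [PJ JP _ JG PG]]] := block_coords blockE.
pose chi := coset_weight k K.
have [b' [symb' bK defb]] :=
  form_projectiveE projb (diag_weight1 (@coset_weightP k _ K G)).
have PX p D : p \in setX G G -> twist rho p (P *m D *m P^T) = P *m twist rB p D *m P^T.
  move=> Gp; move: (PG p Gp); rewrite /twist; move: (rho p) (rB p) => A D' AP.
  by rewrite !mulmxA AP -!mulmxA -trmx_mul AP trmx_mul.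
pose b0 := P *m b' *m P^T; pose h := P *m b *m P^T.
have symb0 : b0^T = b0 by rewrite /b0 !trmx_mul trmxK symb' mulmxA.
have b0K : inv_form rho (diag_set K) b0.
  by move=> p Kp; rewrite /b0 PX ?(subsetP (diag_sub sKG)) // bK.
have hE : h = \sum_(p in setX G G) chi p.1 *: twist rho p b0.
  rewrite /h defb mulmx_sumr mulmx_suml; apply: eq_bigr => p Gp.
  by rewrite PX // -scalemxAr -scalemxAl.
have Zh : (h \in 'Z(group_ring k G))%MS.
  by apply: inv_form_center => p Gp; rewrite /h PX // [twist _ _ _]bX.
have [Rh _] := center_mxP Zh.
have uh : gring_op rM h \in unitmx.
  (* The inverse of b, transported to kG, inverts h on kG e. *)
  pose Q := J^T *m invmx b *m J.
  have Qh : Q^T *m h = e.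
    apply: trmx_inj; rewrite trmx_mul trmxK (block_tr blockE realE).
    rewrite {1}/h !trmx_mul trmxK symb /Q !mulmxA -(mulmxA (P *m b)) -trmx_mul JP.
    by rewrite trmx1 mulmx1 mulmxK.
  have : gring_op rM Q^T *m gring_op rM h = 1%:M.
    by rewrite -gring_opM // Qh (belongs_gring_op blockE realE eM).
  by case/mulmx1_unit.
pose g2 x y := rM x *m B *m (rM y)^T.
have g2K z x y : x \in G -> y \in G -> z \in G -> g2 (x * z)%g (y * z)%g = g2 x y.
  move=> Gx Gy Gz; transitivity (rM x *m twist rM z B *m (rM y)^T).
    by rewrite /g2 /twist !repr_mxM // trmx_mul !mulmxA.
  by rewrite [twist _ _ _]invB.
have g2L z x y : x \in G -> y \in G -> z \in G ->
    twist rM z (g2 x y) = g2 (z * x)%g (z * y)%g.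
  by move=> Gx Gy Gz; rewrite /twist /g2 !repr_mxM // trmx_mul !mulmxA.
pose BM := \sum_(x in G) \sum_(y in G) b0 (gi x) (gi y) *: g2 x y.
have twBM v : v \in G -> twist rM v BM = \sum_(x in G) \sum_(y in G)
    b0 (gi (x ^ v)%g) (gi (y ^ v)%g) *: g2 x y.
  move=> Gv; rewrite /BM -(sum_conjg (V := 'M[k]_n) _ Gv) twist_sum.
  apply: eq_bigr => x Gx; rewrite -(sum_conjg (V := 'M[k]_n) _ Gv) twist_sum.
  apply: eq_bigr => y Gy; rewrite twistZ g2L ?groupJ //; congr (_ *: _).
  by rewrite !conjgE !mulKVg g2K.
have Gv' (v x : gT) : (v^-1 * x * v = x ^ v)%g by rewrite conjgE mulgA.
exists (B *m (gring_op rM h)^T).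
apply: (form_projectiveI sKG (@coset_weightP k _ K G) (B' := BM)).
- rewrite /BM [RHS]exchange_big raddf_sum /=; apply: eq_bigr => x Gx.
  rewrite raddf_sum /=; apply: eq_bigr => y Gy; rewrite linearZ /=; congr (_ *: _).
    by rewrite -[in RHS]symb0 [RHS]mxE.
  by rewrite /g2 !trmx_mul trmxK symB mulmxA.
- move=> v Kv; have Gv := subsetP sKG v Kv; rewrite twBM //.
  apply: eq_bigr => x Gx; apply: eq_bigr => y Gy; congr (_ *: _).
  have Kvv : (v, v) \in diag_set K by apply/imsetP; exists v.
  by rewrite -{2}(b0K _ Kvv) twist_entry // !Gv'.
- have g2E g x : g \in G -> x \in G -> g2 (x : gT) (g * x)%g = B *m (rM g)^T.
    by move=> Gg Gx; rewrite -{1}[x]mul1g g2K ?group1 // /g2 repr_mx1 mul1mx.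
  have coefh g : g \in G -> gcoef h g
      = \sum_(v in G) \sum_(x in G) chi v * b0 (gi (v^-1 * x)%g) (gi (v^-1 * g * x)%g).
    move=> Gg; rewrite -[g in LHS]mul1g -invg1 -gring_entry // [in LHS]hE sum_setX.
    rewrite summxE; apply: eq_bigr => v Gv; rewrite summxE; apply: eq_bigr => x Gx.
    by rewrite mxE twist_entry // mulg1.
  rewrite gring_op_sum raddf_sum mulmx_sumr /=.
  transitivity (\sum_(g in G) \sum_(v in G) \sum_(x in G)
      (chi v * b0 (gi (v^-1 * x)%g) (gi (v^-1 * g * x)%g)) *: (B *m (rM g)^T)).
    apply: eq_bigr => g Gg; rewrite linearZ /= -scalemxAr coefh // scaler_suml.
    by apply: eq_bigr => v Gv; rewrite scaler_suml.
  rewrite exchange_big /=; apply: eq_bigr => v Gv; rewrite twBM // exchange_big /=.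
  rewrite scaler_sumr -(sum_mulgr (V := 'M[k]_n) _ Gv); apply: eq_bigr => x Gx.
  rewrite -(sum_mulgr (V := 'M[k]_n) (fun y => b0 _ (gi (y ^ v)%g) *: g2 x y) Gx).
  rewrite scaler_sumr; apply: eq_bigr => g Gg; rewrite scalerA g2E //.
  congr (_ * b0 _ _ *: _).
  by rewrite conjgE !mulgA.
by rewrite unitmx_mul uB unitmx_tr.
Qed.

End Restrict.

End BlockVertex.

Theorem theorem1p5 (k : closedFieldType) (char2 : 2%N \in [pchar k])
    (gT : finGroupType) (G : {group gT}) (evenG : (2 %| #|G|)%N)
    (e : 'M[k]_#|G|) (He : block_idempotent e) (realB : real_block e)
    (E : {group gT}) (defE : extended_defect_group e E) :
  [/\ forall n (rM : mx_representation k G n) (V : {group gT}),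
        belongs_to e rM -> mx_indecomposable rM -> sym_type rM ->
        sym_vertex rM V ->
        exists2 g, g \in G & (V :^ g)%g \subset E,
      exists n (rM : mx_representation k G n),
        [/\ mx_irreducible rM, self_dual rM, belongs_to e rM
          & sym_vertex rM E]
    & [/\ block_form e \in unitmx,
          form_projective (block_repr He) (block_form e) (diag_group E)
        & sym_vertex (block_repr He) (diag_group E)]].
Proof.
case: defE => C [c [clC realC Cc sylE]].
have projB : form_projective (block_repr He) (block_form e) (diag_group E).
  have [Y [ZY symY CY]] := real_defect_data He realB clC realC.
  exact: (block_form_projective char2 He realB clC realC Cc sylE ZY symY CY).
have [n [rM [irrM dualM eM vxM]]] :=
  ext_defect_sym_vertex char2 He realB clC realC Cc sylE.
split.
- move=> n' rM' V eM' indM' _ vxV.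
  exact: (sym_vertex_in_ext_defect char2 He realB clC realC Cc sylE eM' indM' vxV).
- by exists n, rM.
have [symBf uBf _] := block_form_X_form He realB.
split=> //; split.
- exact: block_indecomposable.
- by exists (block_form e); apply: block_form_X_form.
- by exists (block_form e).
move=> K sKE projK; have [_ [B BX] _ minE] := vxM.
have gK : group_set [set x | (x, x) \in K].
  apply/group_setP; split=> [|x y]; first by rewrite inE (group1 K).
  by rewrite !inE => Kx Ky; rewrite (groupM Kx Ky).
pose K' := Group gK.
have defK : K :=: diag_group K'.
  apply/setP=> -[x y]; apply/idP/imsetP=> [Kxy | [z]].
    have /imsetP[z _ [Ex Ey]] := subsetP sKE _ Kxy; subst x y.
    by exists z; rewrite // inE.
  by rewrite inE => Kz [-> ->].
have sK'E : K' \subset E.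
  by apply/subsetP=> x; rewrite inE => /(subsetP sKE)/imsetP[z Ez [->]].
have sK'G : K' \subset G by apply: subset_trans sK'E (ext_defect_sub sylE).
have projK' : sym_projective rM K'.
  apply: (block_projective_restrict (blockE := He) realB eM BX sK'G).
  by have <- : K = diag_group K' by apply: val_inj.
by rewrite defK; congr diag_set; apply: minE sK'E projK'.
Qed.
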